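(* For a graph $G$ the following conditions are equivalent: (i) $G$ is Helly; (ii) $G$ is $1$--Helly and weakly modular; (iii) $G$ is clique-Helly and dismantlable; (iv) $G$ is clique-Helly and its clique complex is simply connected. Moreover, if the clique complex $X(G)$ of $G$ is finite-dimensional, then (i)--(iv) are also equivalent to: (v) $G$ is clique-Helly and its clique complex is contractible.
   Context: Graphs are simple, undirected, connected, possibly infinite; $B_r(v)=\{x:d(v,x)\le r\}$. A family of sets has the Helly property if every subfamily of pairwise intersecting members has nonempty intersection. $G$ is Helly if the family of all balls has the Helly property; $1$--Helly if the family of balls of radius $1$ has it; clique-Helly if the family of maximal cliques has it. Weakly modular: for every vertex $u$, (TC) for $v,w$ with $1=d(v,w)<d(u,v)=d(u,w)$ there is a common neighbor $x$ of $v,w$ with $d(u,x)=d(u,v)-1$, and (QC) for $v,w,z$ with $d(v,z)=d(w,z)=1$, $2=d(v,w)\le d(u,v)=d(u,w)=d(u,z)-1$ there is a common neighbor $x$ of $v,w$ with $d(u,x)=d(u,v)-1$. A vertex $x$ is dominated by $y$ in a graph if $B_1(x)\subseteq B_1(y)$ there. $G$ is dismantlable if $V(G)$ admits a well-order $\prec$ such that each vertex $v$ other than the least one has a neighbor $w\prec v$ which dominates $v$ in the subgraph of $G$ induced by $\{u: u\preceq v\}$. The clique complex $X(G)$ is the simplicial complex whose simplices are the finite cliques of $G$. *)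

(* Defs.v *)
From Stdlib Require Import Reals List.
Open Scope R_scope.

Section Graphs.
Variable V : Type.
Variable adj : V -> V -> Prop.

Inductive walk : nat -> V -> V -> Prop :=
| walk0 : forall u, walk 0 u u
| walkS : forall n u v w, adj u v -> walk n v w -> walk (S n) u w.

Definition is_graph : Prop :=
  (forall x, ~ adj x x) /\ (forall x y, adj x y -> adj y x) /\
  (exists x : V, True) /\ (forall x y, exists n, walk n x y).

Definition isdist (u v : V) (n : nat) : Prop :=
  walk n u v /\ forall m, walk m u v -> (n <= m)%nat.

Definition ball (v : V) (r : nat) : V -> Prop :=
  fun x => exists m, (m <= r)%nat /\ walk m v x.

Definition Helly_family (F : (V -> Prop) -> Prop) : Prop :=
  forall S : (V -> Prop) -> Prop,
    (forall A, S A -> F A) ->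
    (forall A B, S A -> S B -> exists x, A x /\ B x) ->
    exists x, forall A, S A -> A x.

Definition is_ball (A : V -> Prop) : Prop :=
  exists v r, forall x, A x <-> ball v r x.

Definition is_ball1 (A : V -> Prop) : Prop :=
  exists v, forall x, A x <-> ball v 1 x.

Definition clique (C : V -> Prop) : Prop :=
  forall x y, C x -> C y -> x <> y -> adj x y.

Definition maximal_clique (C : V -> Prop) : Prop :=
  clique C /\ forall D, clique D -> (forall x, C x -> D x) -> forall x, D x -> C x.

Definition Helly_graph : Prop := Helly_family is_ball.
Definition one_Helly : Prop := Helly_family is_ball1.
Definition clique_Helly : Prop := Helly_family maximal_clique.

Definition weakly_modular : Prop :=
  forall u : V,
    (forall v w k, adj v w -> (1 < k)%nat -> isdist u v k -> isdist u w k ->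
       exists x, adj x v /\ adj x w /\ isdist u x (k - 1)) /\
    (forall v w z k, adj v z -> adj w z -> isdist v w 2 -> (2 <= k)%nat ->
       isdist u v k -> isdist u w k -> isdist u z (S k) ->
       exists x, adj x v /\ adj x w /\ isdist u x (k - 1)).

Definition well_order (le : V -> V -> Prop) : Prop :=
  (forall x, le x x) /\
  (forall x y, le x y -> le y x -> x = y) /\
  (forall x y z, le x y -> le y z -> le x z) /\
  (forall x y, le x y \/ le y x) /\
  (forall P : V -> Prop, (exists x, P x) ->
     exists m, P m /\ forall y, P y -> le m y).

Definition dismantlable : Prop :=
  exists le, well_order le /\
    forall v, (exists u, le u v /\ u <> v) ->
      exists w, adj w v /\ le w v /\ w <> v /\
        forall u, le u v -> (u = v \/ adj u v) -> (u = w \/ adj u w).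

Definition finite_dim_clique_complex : Prop :=
  exists n : nat, ~ exists f : nat -> V,
      forall i j, (i < n)%nat -> (j < n)%nat -> i <> j -> adj (f i) (f j).

Definition list_clique (l : list V) : Prop :=
  forall x y, In x l -> In y l -> x <> y -> adj x y.

Definition sumR (p : V -> R) (l : list V) : R :=
  fold_right (fun x acc => p x + acc) 0 l.

(* points: barycentric coordinate functions supported on a finite clique *)
Definition realization (p : V -> R) : Prop :=
  (forall x, 0 <= p x) /\
  exists l : list V, NoDup l /\ list_clique l /\
    (forall x, p x <> 0 -> In x l) /\ sumR p l = 1.

Definition simplex (l : list V) (p : V -> R) : Prop :=
  realization p /\ forall x, p x <> 0 -> In x l.

(* weak (CW / coherent) topology: U is open iff its trace on every closed
   simplex is open for the Euclidean topology of that simplex *)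
Definition wopen (U : (V -> R) -> Prop) : Prop :=
  (forall p, U p -> realization p) /\
  forall l, list_clique l -> forall p, U p -> simplex l p ->
    exists e, 0 < e /\ forall q, simplex l q ->
      (forall x, In x l -> Rabs (p x - q x) < e) -> U q.

Definition unit_interval (t : R) : Prop := 0 <= t <= 1.

Definition path_cont (g : R -> V -> R) : Prop :=
  (forall t, unit_interval t -> realization (g t)) /\
  forall U, wopen U -> forall t, unit_interval t -> U (g t) ->
    exists e, 0 < e /\ forall s, unit_interval s -> Rabs (s - t) < e -> U (g s).

Definition square_cont (H : R -> R -> V -> R) : Prop :=
  (forall s t, unit_interval s -> unit_interval t -> realization (H s t)) /\
  forall U, wopen U -> forall s t, unit_interval s -> unit_interval t ->
    U (H s t) -> exists e, 0 < e /\ forall s' t',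
      unit_interval s' -> unit_interval t' -> Rabs (s' - s) < e ->
      Rabs (t' - t) < e -> U (H s' t').

Definition homotopy_cont (H : R -> (V -> R) -> V -> R) : Prop :=
  (forall t p, unit_interval t -> realization p -> realization (H t p)) /\
  forall U, wopen U -> forall t p, unit_interval t -> realization p ->
    U (H t p) -> exists e W, 0 < e /\ wopen W /\ W p /\
      forall s q, unit_interval s -> Rabs (s - t) < e -> W q -> U (H s q).

Definition path_connected_X : Prop :=
  forall p q, realization p -> realization q ->
    exists g, path_cont g /\ g 0 = p /\ g 1 = q.

Definition loops_trivial_X : Prop :=
  forall g p, path_cont g -> g 0 = p -> g 1 = p ->
    exists H, square_cont H /\
      (forall s, unit_interval s -> H s 0 = g s) /\
      (forall s, unit_interval s -> H s 1 = p) /\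
      (forall t, unit_interval t -> H 0 t = p /\ H 1 t = p).

Definition simply_connected_X : Prop :=
  (exists p, realization p) /\ path_connected_X /\ loops_trivial_X.

Definition contractible_X : Prop :=
  exists H p0, realization p0 /\ homotopy_cont H /\
    (forall p, realization p -> H 0 p = p) /\
    (forall p, realization p -> H 1 p = p0).

End Graphs.

(* Main.v *)
Require Import Defs.
From Stdlib Require Import Reals List.
From Stdlib Require Import Lra Lia Arith Classical ClassicalEpsilon Relations.
From Stdlib Require Import FunctionalExtensionality PropExtensionality.
From Stdlib Require Import Permutation.
From mathcomp Require ssreflect ssrbool boolp wochoice.

(* Call a graph ball-dominated if, for all [u <> v], some vertex closer to [u] than [v] is
   adjacent or equal to all neighbours of [v] that are not farther from [u] than [v]. This
   property is the pivot. It lets one straighten geodesics, which reduces the Helly property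
   for balls to that for unit balls, and the latter to that for maximal cliques. It follows
   from 1-Hellyness with the triangle and quadrangle conditions. Sorting the vertices by
   their distance from [u] it gives a dismantling order, and sliding each vertex along its
   successive dominators contracts the clique complex onto [u] in its weak topology, without
   any bound on the dimension. Conversely, if closed walks lift to closed walks in every cover
   (which follows from a dismantling order, or by cutting a null-homotopy into a fine grid),
   a clique-Helly graph is ball-dominated: its universal cover is built sphere by sphere around
   [u] so as to be ball-dominated towards [u], clique-Hellyness providing the dominators, and
   the cover must be the graph itself. *)

Set Bullet Behavior "Strict Subproofs".

(** * Well-orders and maximal cliques *)

(** Ball domination is asked towards every vertex, since each centre of a ball in turn serves as the
    base vertex. Graph and cliques may be infinite, so maximal cliques are built along a well-order,
    and every induction runs on something finite or well-founded: the excess by which a vertex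
    misses a whole family of balls, the largest vertex of a finite closed walk, the level in the
    cover. Testing simple connectedness on lifts of closed walks avoids forming a fundamental group
    or the realization of a cover. Since covers are isomorphic on unit balls, clique-Hellyness is
    applied in the graph itself and its outcome is lifted. The weak topology raises two obstacles.
    Convergence of coordinates does not give convergence, so nearby values must lie in finitely many
    simplices shared with the limit. Openness in the product with the interval has to be derived
    from openness on single simplices, which takes a tube argument. Unbounded distances fit into the
    unit time interval because the descent from level j+1 to level j occupies the times from
    2^-(j+1) to 2^-j, so far vertices move first. *)

Module WellOrdering.
Import ssreflect ssrbool boolp wochoice.

Lemma min_of_well_ordering (T : Type) : exists R : T -> T -> Prop,
  forall P : T -> Prop, (exists x, P x) ->
  exists m, P m /\ (forall y, P y -> R m y) /\
    forall m', P m' -> (forall y, P y -> R m' y) -> m = m'.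
Proof.
case: (well_ordering_principle (boolp_classicType__canonical__eqtype_Equality T)) => R wR.
exists (fun x y => R x y) => P [x Px].
case: (wR [pred z : T | `[< P z >]]).
  by exists x; apply/asboolP.
move=> m [[/asboolP Pm lbm] uniq]; exists m; split => //; split.
  by move=> y Py; apply/lbm/asboolP.
move=> m' Pm' lbm'; apply: uniq; split; first exact/asboolP.
by move=> y /asboolP Py; apply: lbm'.
Qed.

End WellOrdering.

(** The order axioms are read off from least elements of sets of at most three points; uniqueness of
    the least element gives antisymmetry. *)
Lemma well_order_exists (T : Type) : exists le : T -> T -> Prop, well_order T le.
Proof.
  destruct (WellOrdering.min_of_well_ordering T) as [R HR]. exists R.
  assert (Hpair : forall x y, (R x y \/ R y x) /\ (R x y -> R y x -> x = y) /\ R x x).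
  { intros x y.
    destruct (HR (fun z => z = x \/ z = y)) as [m [Hm [Hlb Hu]]]; [eauto|].
    destruct (HR (fun z => z = x)) as [m1 [-> [Hx _]]]; [eauto|].
    destruct (HR (fun z => z = y)) as [m2 [-> [Hy _]]]; [eauto|].
    split; [destruct Hm as [-> | ->]; [left|right]; apply Hlb; auto|].
    split; [|now apply Hx].
    intros H1 H2. transitivity m; [symmetry|]; apply Hu; auto;
      intros z [-> | ->]; auto. }
  split; [intros x; apply (Hpair x x)|].
  split; [intros x y; apply (Hpair x y)|].
  split.
  { intros x y z Hxy Hyz.
    destruct (HR (fun t => t = x \/ t = y \/ t = z)) as [m [Hm [Hlb _]]]; [eauto|].
    destruct Hm as [-> | [-> | ->]]; auto.
    - rewrite (proj1 (proj2 (Hpair x y)) Hxy (Hlb x (or_introl eq_refl))). exact Hyz.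
    - rewrite <- (proj1 (proj2 (Hpair y z)) Hyz (Hlb y (or_intror (or_introl eq_refl)))).
      exact Hxy. }
  split; [intros x y; apply (Hpair x y)|].
  intros P HP. destruct (HR P HP) as [m [Pm [Hlb _]]]. eauto.
Qed.

Definition strict {T} (le : T -> T -> Prop) x y := le x y /\ x <> y.

Lemma well_order_wf (T : Type) (le : T -> T -> Prop) :
  well_order T le -> well_founded (strict le).
Proof.
  intros (_ & Hanti & _ & _ & Hmin) x. apply NNPP. intros Hx.
  destruct (Hmin (fun y => ~ Acc (strict le) y)) as [m [Hm Hlb]]; [eauto|].
  apply Hm. constructor. intros y [Hy Hne]. apply NNPP. intros Hn.
  apply Hne, Hanti; auto.
Qed.

(* Greedy extension along a well-order of the vertex set. *)
Lemma maximal_clique_extension (T : Type) (N : T -> T -> Prop) (C : T -> Prop) :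
  (forall x, N x x) -> (forall x y, N x y -> N y x) ->
  (forall x y, C x -> C y -> N x y) ->
  exists K : T -> Prop,
    (forall x, C x -> K x) /\ (forall x y, K x -> K y -> N x y) /\
    (forall z, (forall x, K x -> N z x) -> K z).
Proof.
  intros Hrefl Hsym HC.
  destruct (well_order_exists T) as [le Hle].
  pose proof (well_order_wf T le Hle) as Hwf.
  destruct Hle as (_ & _ & _ & Htot & _).
  set (step := fun (y : T) (rec : forall x, strict le x y -> Prop) =>
     (forall c, C c -> N y c) /\ forall x (H : strict le x y), rec x H -> N y x).
  set (K := Fix Hwf (fun _ => Prop) step).
  assert (HK : forall y, K y <->
     (forall c, C c -> N y c) /\ forall x, strict le x y -> K x -> N y x).
  { intros y. unfold K at 1. rewrite Fix_eq; [reflexivity|].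
    intros x f g Hfg. replace g with f; [reflexivity|].
    extensionality z. extensionality Hz. apply Hfg. }
  assert (HKK : forall x y, K x -> K y -> N x y).
  { intros x y Kx Ky. destruct (classic (x = y)) as [-> | Hne]; [apply Hrefl|].
    destruct (Htot x y) as [Hxy | Hxy].
    - apply Hsym, (proj1 (HK y) Ky); [split|]; auto.
    - apply (proj1 (HK x) Kx); [split|]; auto. }
  assert (HCK : forall c, C c -> K c).
  { intros c Cc. apply HK. split; [auto|]. intros x _ Kx. apply Hsym.
    exact (proj1 (proj1 (HK x) Kx) c Cc). }
  exists K. split; [exact HCK|]. split; [exact HKK|].
  intros z Hz. apply HK. split; auto.
Qed.

(** * Distances and balls *)

Open Scope nat_scope.

Section GraphDistance.
Variables (V : Type) (adj : V -> V -> Prop).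
Hypothesis G : is_graph V adj.

Definition near (x y : V) : Prop := x = y \/ adj x y.

Lemma adj_sym x y : adj x y -> adj y x.
Proof. apply G. Qed.

Lemma near_refl x : near x x.
Proof. now left. Qed.

Lemma near_sym x y : near x y -> near y x.
Proof. intros [-> | H]; [now left | right; now apply adj_sym]. Qed.

Lemma near_adj x y : near x y -> x <> y -> adj x y.
Proof. intros [-> | H] Hne; [now destruct Hne | exact H]. Qed.

Lemma walk_cat m n u v w : walk V adj m u v -> walk V adj n v w -> walk V adj (m + n) u w.
Proof. induction 1; simpl; auto. intros. econstructor; eauto. Qed.

Lemma walk_rev n u v : walk V adj n u v -> walk V adj n v u.
Proof.
  induction 1 as [u|n u v w Huv _ IH]; [constructor|].
  replace (S n) with (n + 1) by lia. apply walk_cat with v; auto.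
  apply (walkS V adj 0 v u u); [now apply adj_sym | constructor].
Qed.

Lemma isdist_exists u v : exists n, isdist V adj u v n.
Proof.
  destruct G as (_ & _ & _ & Hc). destruct (Hc u v) as [n Hn].
  induction n as [n IH] using (well_founded_induction lt_wf).
  destruct (classic (exists m, m < n /\ walk V adj m u v)) as [[m [Hm Hw]] | Hno];
    [eauto|].
  exists n. split; auto. intros m Hm. apply Nat.nlt_ge. intros Hlt. apply Hno. eauto.
Qed.

Definition gdist (u v : V) : nat :=
  proj1_sig (constructive_indefinite_description _ (isdist_exists u v)).

Lemma isdist_dist u v : isdist V adj u v (gdist u v).
Proof. apply (proj2_sig (constructive_indefinite_description _ (isdist_exists u v))). Qed.

Lemma isdist_iff u v k : isdist V adj u v k <-> gdist u v = k.
Proof.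
  destruct (isdist_dist u v) as [H1 H2]. split; [|intros <-; split; auto].
  intros [H3 H4]. apply Nat.le_antisymm; auto.
Qed.

Lemma gdist_le_walk u v n : walk V adj n u v -> gdist u v <= n.
Proof. apply isdist_dist. Qed.

Lemma ball_dist u v r : ball V adj u r v <-> gdist u v <= r.
Proof.
  split.
  - intros [m [Hm Hw]]. apply gdist_le_walk in Hw. lia.
  - intros H. exists (gdist u v). split; auto. apply isdist_dist.
Qed.

Lemma gdist_refl u : gdist u u = 0.
Proof. assert (H : gdist u u <= 0) by (apply gdist_le_walk; constructor). lia. Qed.

Lemma gdist_0 u v : gdist u v = 0 -> u = v.
Proof. intros H. pose proof (proj1 (isdist_dist u v)) as W. rewrite H in W. now inversion W. Qed.

Lemma gdist_sym u v : gdist u v = gdist v u.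
Proof. apply Nat.le_antisymm; apply gdist_le_walk, walk_rev, isdist_dist. Qed.

Lemma gdist_tri u v w : gdist u w <= gdist u v + gdist v w.
Proof. apply gdist_le_walk, walk_cat with v; apply isdist_dist. Qed.

Lemma gdist_near u v : gdist u v <= 1 <-> near u v.
Proof.
  split.
  - intros H. pose proof (proj1 (isdist_dist u v)) as W.
    destruct (gdist u v) as [|[|k]]; [| |lia]; inversion W as [|? ? ? ? Ha W']; subst;
      [now left|]. inversion W'; subst. now right.
  - intros [-> | H]; [rewrite gdist_refl; lia|]. apply gdist_le_walk.
    econstructor; [eauto|constructor].
Qed.

Lemma ball1_near u v : ball V adj u 1 v <-> near u v.
Proof. rewrite ball_dist. apply gdist_near. Qed.

Lemma near_dist_le u v w : near v w -> gdist u w <= S (gdist u v).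
Proof. intros H. apply gdist_near in H. pose proof (gdist_tri u v w). lia. Qed.

Lemma gdist_pred u v k : gdist u v = S k -> exists x, adj v x /\ gdist u x = k.
Proof.
  rewrite gdist_sym. intros H. pose proof (proj1 (isdist_dist v u)) as W. rewrite H in W.
  inversion W as [|n a x b Ha Hw]; subst. exists x. split; auto.
  apply gdist_le_walk in Hw. rewrite gdist_sym in Hw.
  pose proof (near_dist_le u x v (or_intror (adj_sym _ _ Ha))).
  rewrite (gdist_sym u v) in *. lia.
Qed.

Lemma clique_near (C : V -> Prop) : clique V adj C <-> forall x y, C x -> C y -> near x y.
Proof.
  split; intros H x y Hx Hy.
  - destruct (classic (x = y)); [now left | right; auto].
  - intros Hne. apply near_adj; auto.
Qed.

(* [s] is a common vertex of all maximal cliques containing a member of [F]. *)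
Lemma clique_Helly_center (F : (V -> Prop) -> Prop) : clique_Helly V adj ->
  (forall C, F C -> forall x y, C x -> C y -> near x y) ->
  (forall C D, F C -> F D -> exists x, C x /\ D x) ->
  exists s, forall C y, F C -> (forall x, C x -> near x y) -> near s y.
Proof.
  intros HCH Hcl Hint.
  destruct (HCH (fun D => maximal_clique V adj D /\ exists C, F C /\ forall x, C x -> D x))
    as [s Hs].
  - now intros A [HA _].
  - intros A B [_ [C [FC HCA]]] [_ [D [FD HDB]]].
    destruct (Hint C D FC FD) as [x [? ?]]. eauto.
  - exists s. intros C y FC Hy.
    (* A maximal clique through [C] and [y] is a member of the family, so it contains [s]. *)
    destruct (maximal_clique_extension V near (fun x => C x \/ x = y)) as [K [HK1 [HK2 HK3]]].
    + apply near_refl.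
    + apply near_sym.
    + intros a b [Ha | ->] [Hb | ->]; eauto using near_refl, near_sym.
    + apply HK2; [|auto]. apply Hs. split; [split|].
      * now apply clique_near.
      * intros D HD HKD x Dx. apply HK3. intros z Kz.
        apply (proj1 (clique_near D) HD); auto.
      * eauto.
Qed.

(** Two unit balls meet exactly when their centres are at distance at most two, so the property can
    be stated on centres alone. *)
Definition one_Helly_center : Prop :=
  forall I : V -> Prop, (forall v w, I v -> I w -> gdist v w <= 2) ->
  exists s, forall v, I v -> near v s.

Lemma gdist_le_2 v w x : near v x -> near w x -> gdist v w <= 2.
Proof.
  intros H1 H2. apply gdist_near in H1, H2. rewrite (gdist_sym w x) in H2.
  pose proof (gdist_tri v x w). lia.
Qed.

(** A point of a geodesic at the right place: balls meet as soon as the sum of their radii reaches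
    the distance of their centres. *)
Lemma gdist_mid v w k r : gdist v w <= k + r -> exists x, gdist v x <= k /\ gdist w x <= r.
Proof.
  revert v; induction k as [|k IH]; intros v H.
  - exists v. rewrite gdist_refl, gdist_sym. split; lia.
  - destruct (Nat.le_gt_cases (gdist v w) (k + r)) as [Hle | Hgt].
    + destruct (IH v Hle) as [x [? ?]]. exists x. lia.
    + assert (E : gdist w v = S (k + r)) by (rewrite gdist_sym; lia).
      destruct (gdist_pred _ _ _ E) as [v' [Hv' E']].
      destruct (IH v') as [x [H1 H2]]; [rewrite gdist_sym; lia|].
      exists x. split; auto. pose proof (gdist_tri v v' x).
      assert (gdist v v' <= 1) by (apply gdist_near; now right). lia.
Qed.

Lemma one_Helly_iff : one_Helly V adj <-> one_Helly_center.
Proof.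
  split.
  - intros H I HI. destruct (H (fun A => exists v, I v /\ forall x, A x <-> ball V adj v 1 x))
      as [s Hs].
    + intros A [v [_ Hv]]. now exists v.
    + intros A B [v [Iv Hv]] [w [Iw Hw]].
      destruct (gdist_mid v w 1 1 (HI v w Iv Iw)) as [x Hx].
      exists x. now rewrite Hv, Hw, !ball_dist.
    + exists s. intros v Iv. apply ball1_near. apply (Hs (ball V adj v 1)). exists v. tauto.
  - intros H S HS Hint.
    destruct (H (fun v => exists A, S A /\ forall x, A x <-> ball V adj v 1 x)) as [s Hs].
    + intros v w [A [SA HA]] [B [SB HB]]. destruct (Hint A B SA SB) as [x [Ax Bx]].
      rewrite HA, ball1_near in Ax. rewrite HB, ball1_near in Bx. eauto using gdist_le_2.
    + exists s. intros A SA. destruct (HS A SA) as [v Hv]. apply Hv, ball1_near, Hs. eauto.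
Qed.

(** The family is a relation [J] and not a radius function, because a ball, as a set, need not
    determine its centre and radius. *)
Lemma Helly_iff : Helly_graph V adj <->
  forall J : V -> nat -> Prop,
    (forall v r w t, J v r -> J w t -> gdist v w <= r + t) ->
    exists s, forall v r, J v r -> gdist v s <= r.
Proof.
  split.
  - intros H J HJ.
    destruct (H (fun A => exists v r, J v r /\ forall x, A x <-> ball V adj v r x)) as [s Hs].
    + intros A [v [r [_ Hv]]]. now exists v, r.
    + intros A B [v [r [Jv Hv]]] [w [t [Jw Hw]]].
      destruct (gdist_mid v w r t (HJ v r w t Jv Jw)) as [x Hx].
      exists x. now rewrite Hv, Hw, !ball_dist.
    + exists s. intros v r Jv. apply ball_dist, (Hs (ball V adj v r)). exists v, r. tauto.
  - intros H S HS Hint.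
    destruct (H (fun v r => exists A, S A /\ forall x, A x <-> ball V adj v r x)) as [s Hs].
    + intros v r w t [A [SA HA]] [B [SB HB]]. destruct (Hint A B SA SB) as [x [Ax Bx]].
      rewrite HA, ball_dist in Ax. rewrite HB, ball_dist in Bx.
      pose proof (gdist_tri v x w). rewrite (gdist_sym w x) in Bx. lia.
    + exists s. intros A SA. destruct (HS A SA) as [v [r Hv]]. apply Hv, ball_dist, Hs. eauto.
Qed.

End GraphDistance.

(** * Domination *)

Section Domination.
Variables (V : Type) (adj : V -> V -> Prop).
Hypothesis G : is_graph V adj.
Local Hint Resolve near_refl near_sym : core.
Notation near := (near V adj).
Notation gdist := (gdist V adj G).

Lemma nonempty : exists x : V, True.
Proof. apply G. Qed.

Definition dominates_toward (u v x : V) : Prop :=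
  gdist u x < gdist u v /\ forall w, near v w -> gdist u w <= gdist u v -> near x w.

Definition ball_dominated : Prop :=
  forall u v, u <> v -> exists x, dominates_toward u v x.

(** Domination applied to [w = v] makes [x] a neighbour of [v], so the distance drops by exactly
    one. *)
Lemma dominator u v k : ball_dominated -> gdist u v = S k ->
  exists x, gdist u x = k /\ near v x /\ forall w, near v w -> gdist u w <= S k -> near x w.
Proof.
  intros HD E. destruct (HD u v) as [x [H1 H2]].
  { intros ->. rewrite gdist_refl in E. discriminate. }
  rewrite E in *. assert (Hx : near x v) by (apply H2; auto; lia).
  exists x. split; [|split; auto].
  pose proof (near_dist_le V adj G u x v Hx). lia.
Qed.

(* Domination removes weak local maxima of the distance to [b] along a geodesic from [v] to [a]. *)
Lemma step_toward_two (HD : ball_dominated) p : forall v a b r,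
  gdist v a = S p -> gdist v b <= S r -> gdist a b <= p + r ->
  exists x, near v x /\ gdist x a = p /\ gdist x b <= r.
Proof.
  induction p as [|p IH]; intros v a b r Hva Hvb Hab.
  - exists a. rewrite gdist_refl. repeat split; auto.
    apply gdist_near with G. lia.
  - rewrite (gdist_sym V adj G) in Hva.
    destruct (gdist_pred V adj G a v (S p) Hva) as [x [Hvx Hx]].
    assert (Hvx' : near v x) by now right.
    pose proof (near_dist_le V adj G b v x Hvx') as Hbx.
    rewrite (gdist_sym V adj G v b) in Hvb. rewrite (gdist_sym V adj G a x) in Hx.
    (* The induction hypothesis is used with radius [S r], so the vertex [y] after next is only
       known to be within [S r] of [b]; it remains to improve the middle vertex [x]. *)
    destruct (IH x a b (S r)) as [y [Hxy [Hya Hyb]]];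
      [lia | rewrite (gdist_sym V adj G x b); lia | lia |].
    rewrite (gdist_sym V adj G) in Hya, Hyb.
    assert (Hreach : forall z, near z v -> near z y -> gdist a z = S p).
    { intros z Hzv Hzy. pose proof (near_dist_le V adj G a z v Hzv).
      apply (near_sym V adj G) in Hzy. pose proof (near_dist_le V adj G a y z Hzy). lia. }
    (* Both [v] and [y] are within [S r <= S q] of [b]. Hence the dominator of a common neighbour
       [s] towards [b] is again a common neighbour, and at most two such moves bring [x] within [r]
       of [b]. *)
    assert (Hlower : forall q s, near s v -> near s y -> r <= q -> gdist b s = S q ->
              exists z, near z v /\ near z y /\ gdist b z = q).
    { intros q s Hsv Hsy Hq Hs. destruct (dominator b s q HD Hs) as [z [Hz [_ Hdom]]].
      exists z. split; [|split; auto]; apply Hdom; auto; lia. }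
    assert (Hfinal : exists z, near z v /\ near z y /\ gdist b z <= r).
    { assert (Hd : gdist b x <= r \/ gdist b x = S r \/ gdist b x = S (S r)) by lia.
      destruct Hd as [Hd | [Hd | Hd]].
      - exists x. auto.
      - destruct (Hlower r x) as [z [? [? ?]]]; auto. exists z. repeat split; auto. lia.
      - destruct (Hlower (S r) x) as [z [? [? ?]]]; auto.
        destruct (Hlower r z) as [t [? [? ?]]]; auto. exists t. repeat split; auto. lia. }
    destruct Hfinal as [z [Hzv [Hzy Hz]]]. exists z. split; auto.
    rewrite (gdist_sym V adj G z a), (gdist_sym V adj G z b). auto.
Qed.

(** The Helly property for three balls of which one is a unit ball: if [v] misses one of the other
    two, a single step towards its centre suffices. *)
Lemma three_balls (HD : ball_dominated) v a b p r :
  gdist v a <= S p -> gdist v b <= S r -> gdist a b <= p + r ->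
  exists x, near v x /\ gdist a x <= p /\ gdist b x <= r.
Proof.
  intros Ha Hb Hab. rewrite !(gdist_sym V adj G v) in *.
  destruct (Nat.eq_dec (gdist a v) (S p)) as [E | E].
  - destruct (step_toward_two HD p v a b r) as [x [? [? ?]]];
      try (rewrite (gdist_sym V adj G v); lia); auto.
    exists x. rewrite (gdist_sym V adj G a x), (gdist_sym V adj G b x). repeat split; auto; lia.
  - destruct (Nat.eq_dec (gdist b v) (S r)) as [E' | E'].
    + destruct (step_toward_two HD r v b a p) as [x [? [? ?]]];
        try (rewrite (gdist_sym V adj G v); lia); [rewrite gdist_sym; lia|].
      exists x. rewrite (gdist_sym V adj G a x), (gdist_sym V adj G b x). repeat split; auto; lia.
    + exists v. repeat split; auto; lia.
Qed.

(* Inside the unit ball of [v], the unit ball of [z] agrees with the ball of radius [S R]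
   around [a]. *)
Lemma unit_ball_proxy (HD : ball_dominated) v a R :
  gdist a v <= S (S R) ->
  exists z, gdist a z <= R /\ forall y, near v y -> gdist a y <= S R -> near z y.
Proof.
  intros H. assert (Hc : gdist a v <= R \/ gdist a v = S R \/ gdist a v = S (S R)) by lia.
  destruct Hc as [Hc | [Hc | Hc]].
  - exists v. auto.
  - destruct (dominator a v R HD Hc) as [x [Hx [_ Hdom]]]. exists x. split; [lia | auto].
  - destruct (dominator a v (S R) HD Hc) as [x [Hx [_ Hdom]]].
    destruct (dominator a x R HD Hx) as [z [Hz [_ Hdom']]].
    exists z. split; [lia|]. intros y Hy Hay. apply Hdom'; auto.
Qed.

(** Each ball is replaced by the unit ball of a proxy, which has the same trace on the unit ball of
    [v]. By [three_balls] these traces meet pairwise, so 1-Hellyness applies to the proxies together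
    with [v]. *)
Lemma common_step (HD : ball_dominated) (H1 : one_Helly_center V adj G)
  (J : V -> nat -> Prop) v :
  (forall a R, J a R -> gdist a v <= S R) ->
  (forall a R b T, J a R -> J b T -> gdist a b <= R + T) ->
  exists x, near v x /\ forall a R, J a R -> gdist a x <= R.
Proof.
  intros Hv HJ.
  (* A ball of radius 0 has no proxy, but its centre is then the only candidate and it works. *)
  destruct (classic (exists a, J a 0)) as [[a Ja] | Hno].
  - exists a. split.
    + apply (near_sym V adj G), (gdist_near V adj G), Hv, Ja.
    + intros b R Jb. specialize (HJ b R a 0 Jb Ja). lia.
  - set (proxy := fun z a R => gdist a z <= R /\ forall y, near v y -> gdist a y <= S R -> near z y).
    destruct (H1 (fun z => z = v \/ exists a R, J a (S R) /\ proxy z a R)) as [x Hx].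
    + assert (Hpair : forall z w a R b T, J a (S R) -> proxy z a R -> J b (S T) ->
                proxy w b T -> exists y, near v y /\ near z y /\ near w y).
      { intros z w a R b T Ja [_ Hz] Jb [_ Hw].
        destruct (three_balls HD v a b (S R) (S T)) as [y [? [? ?]]].
        - rewrite gdist_sym. auto.
        - rewrite gdist_sym. auto.
        - eauto.
        - exists y. auto. }
      intros z w [-> | [a [R [Ja Hz]]]] [-> | [b [T [Jb Hw]]]].
      * rewrite gdist_refl. lia.
      * destruct (Hpair w w b T b T) as [y [? [? ?]]]; auto. eauto using gdist_le_2.
      * destruct (Hpair z z a R a R) as [y [? [? ?]]]; auto. eauto using gdist_le_2.
      * destruct (Hpair z w a R b T) as [y [? [? ?]]]; auto. eauto using gdist_le_2.
    + exists x. split; [auto|]. intros a [|R] Ja; [destruct Hno; eauto|].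
      destruct (unit_ball_proxy HD v a R) as [z Hz]; [auto|].
      assert (Hzx : near z x) by (apply Hx; right; exists a, R; auto).
      pose proof (near_dist_le V adj G a z x Hzx). destruct Hz. lia.
Qed.

(** The excess [k], by which [v] may miss the balls, falls by one when [common_step] is applied to
    the balls enlarged by [k]. A uniform finite excess to start from exists even for infinite
    families: the centre of one ball of radius [r] has excess at most [r]. *)
Lemma Helly_of_ball_dominated : ball_dominated -> one_Helly V adj -> Helly_graph V adj.
Proof.
  intros HD H1. apply (one_Helly_iff V adj G) in H1. apply (Helly_iff V adj G). intros J HJ.
  assert (Hind : forall k v, (forall a R, J a R -> gdist a v <= R + k) ->
            exists s, forall a R, J a R -> gdist a s <= R).
  { induction k as [|k IH]; intros v Hv.
    - exists v. intros a R Ja. specialize (Hv a R Ja). lia.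
    - destruct (common_step HD H1 (fun a R => exists R', R = R' + k /\ J a R') v)
        as [x [_ Hx]].
      + intros a R [R' [-> Ja]]. specialize (Hv a R' Ja). lia.
      + intros a R b T [R' [-> Ja]] [T' [-> Jb]]. specialize (HJ a R' b T' Ja Jb). lia.
      + apply (IH x). eauto. }
  destruct (classic (exists v r, J v r)) as [[v [r Jv]] | Hno].
  - apply (Hind r v). intros a R Ja. eauto.
  - destruct nonempty as [x _]. exists x. intros v r Jv. destruct Hno. eauto.
Qed.

(** The unit balls are traded for pairwise intersecting cliques. All of these pass through one
    clique [K] near a chosen [v0], which is large enough to contain a common neighbour of any two
    members of [I]. *)
Lemma one_Helly_of_clique_Helly :
  ball_dominated -> clique_Helly V adj -> one_Helly V adj.
Proof.
  intros HD HCH. apply (one_Helly_iff V adj G). intros I HI.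
  destruct (classic (exists v, I v)) as [[v0 I0] | Hno].
  2:{ destruct nonempty as [x _]. exists x. intros v Iv. destruct Hno. eauto. }
  set (good := fun i t => near v0 t /\ near t i /\
         forall y, near v0 y -> gdist i y <= 2 -> near t y).
  assert (Hgood : forall i, I i -> exists t, good i t).
  { intros i Ii. pose proof (HI i v0 Ii I0) as Hd.
    destruct (Nat.le_gt_cases (gdist i v0) 1) as [Hle | Hgt].
    - exists v0. split; auto. split; [|auto].
      apply (near_sym V adj G), (gdist_near V adj G), Hle.
    - destruct (dominator i v0 1 HD ltac:(lia)) as [t [Ht [Hn Hdom]]].
      exists t. split; [auto|split; [|auto]].
      apply (near_sym V adj G), (gdist_near V adj G). lia. }
  (* A vertex [y] near [v0], [i] and [j] is near [t]. Thus [t] is within two of [j], and then [s] is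
     near it. *)
  assert (Hgg : forall i j t s, I i -> I j -> good i t -> good j s -> near t s).
  { intros i j t s Ii Ij [Ht [Hti Hdt]] [Hs [Hsj Hds]].
    destruct (three_balls HD v0 i j 1 1) as [y [Hy [Hiy Hjy]]]; auto.
    apply (near_sym V adj G), Hds; auto.
    assert (Hty : near y t) by (apply (near_sym V adj G), Hdt; auto).
    pose proof (near_dist_le V adj G j y t Hty). lia. }
  destruct (maximal_clique_extension V near (fun t => exists i, I i /\ good i t))
    as [K [HK1 [HK2 HK3]]]; auto.
  { intros x y [i [Ii Hi]] [j [Ij Hj]]. eauto. }
  assert (HK4 : forall i, I i -> exists t, K t /\ near t i).
  { intros i Ii. destruct (Hgood i Ii) as [t Ht]. exists t.
    split; [apply HK1; eauto | exact (proj1 (proj2 Ht))]. }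
  assert (HK5 : forall i k, I i -> K k -> gdist i k <= 2).
  { intros i k Ii Kk. destruct (HK4 i Ii) as [t [Kt Ht]]. eauto using gdist_le_2. }
  (* If [k] in [K] is near [i] but at distance two from [j], its dominator towards [j] is near [i]
     and near all of [K], since these are all within two of [j]; by maximality it lies in [K]. *)
  assert (HK6 : forall i j, I i -> I j -> exists x, K x /\ near x i /\ near x j).
  { intros i j Ii Ij. destruct (HK4 i Ii) as [k [Kk Hk]].
    destruct (Nat.le_gt_cases (gdist j k) 1) as [Hle | Hgt].
    - exists k. split; auto. split; auto. apply (near_sym V adj G), (gdist_near V adj G), Hle.
    - pose proof (HK5 j k Ij Kk).
      destruct (dominator j k 1 HD ltac:(lia)) as [x [Hx [Hkx Hdom]]].
      exists x. split; [|split].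
      + apply HK3. intros y Ky. apply Hdom; auto.
      + apply Hdom; auto.
      + apply (near_sym V adj G), (gdist_near V adj G). lia. }
  (* A vertex near all of [star i] always exists, namely [i], so the common centre of these cliques
     is near every [i]. *)
  set (star := fun i x => (K x /\ near x i) \/ x = i).
  destruct (clique_Helly_center V adj G
              (fun C => exists i, I i /\ C = star i) HCH) as [s Hs].
  - intros C [i [Ii ->]] x y [[Kx Hx] | ->] [[Ky Hy] | ->]; auto.
  - intros C C' [i [Ii ->]] [j [Ij ->]]. destruct (HK6 i j Ii Ij) as [x [Kx [Hxi Hxj]]].
    exists x. split; left; auto.
  - exists s. intros i Ii. apply (near_sym V adj G), (Hs (star i)); [eauto|].
    intros x [[_ Hx] | ->]; auto.
Qed.

(** * Ball domination from the triangle and quadrangle conditions *)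

Section OneHellyWeaklyModular.
Hypothesis H1 : one_Helly_center V adj G.
Hypothesis WM : weakly_modular V adj.

Lemma triangle_condition u v w k : adj v w -> gdist u v = S (S k) -> gdist u w = S (S k) ->
  exists x, near v x /\ near w x /\ gdist u x = S k.
Proof.
  intros Ha Hv Hw. destruct (WM u) as [TC _].
  destruct (TC v w (S (S k))) as [x [Hxv [Hxw Hx]]]; auto; try lia.
  - now apply isdist_iff with G.
  - now apply isdist_iff with G.
  - exists x. apply (isdist_iff V adj G) in Hx. simpl in Hx.
    repeat split; auto; apply (near_sym V adj G); now right.
Qed.

Lemma quadrangle_condition u v w z k : near v z -> near w z ->
  gdist u v = S (S k) -> gdist u w = S (S k) -> gdist u z = S (S (S k)) -> ~ near v w ->
  exists x, near v x /\ near w x /\ gdist u x = S k.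
Proof.
  intros Hvz Hwz Hv Hw Hz Hn. destruct (WM u) as [_ QC].
  destruct (QC v w z (S (S k))) as [x [Hxv [Hxw Hx]]]; auto; try lia;
    try (now apply isdist_iff with G).
  - apply near_adj; auto. intros ->. lia.
  - apply near_adj; auto. intros ->. lia.
  - apply isdist_iff with G. pose proof (gdist_le_2 V adj G v w z Hvz Hwz).
    destruct (Nat.le_gt_cases (gdist v w) 1) as [Hle | Hgt]; [|lia].
    destruct Hn. now apply gdist_near with G.
  - exists x. apply (isdist_iff V adj G) in Hx. simpl in Hx.
    repeat split; auto; apply (near_sym V adj G); now right.
Qed.

(** Induction on the distance from [u] to [v]. Dominators of the lower neighbours of [v] exist by
    induction; 1-Hellyness singles out a lower neighbour [t] near all the others, and the dominator
    of [t] serves as the vertex two levels below [v] that is close to all of [A]. *)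
Lemma ball_dominated_of_one_Helly : ball_dominated.
Proof.
  intros u.
  assert (Hind : forall k v, gdist u v = S k -> exists x, gdist u x = k /\
            forall w, near v w -> gdist u w <= S k -> near x w).
  { induction k as [k IH] using (well_founded_induction lt_wf). intros v Hv.
    set (A := fun w => near v w /\ gdist u w <= S k).
    assert (HAA : forall w w', A w -> A w' -> gdist w w' <= 2).
    { intros w w' [Hw _] [Hw' _]. eauto using gdist_le_2. }
    (* It suffices to find z two steps closer to u such that z is within distance two of A. *)
    assert (Hsuff : forall z, gdist u z <= k - 1 -> (forall w, A w -> gdist z w <= 2) ->
              exists x, gdist u x = k /\ forall w, A w -> near x w).
    { intros z Hz HzA. destruct (H1 (fun y => y = z \/ A y)) as [x Hx].
      - intros y y' [-> | Hy] [-> | Hy']; auto.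
        + rewrite gdist_refl. lia.
        + rewrite gdist_sym. auto.
      - assert (Hxv : near v x) by (apply Hx; right; split; auto; lia).
        assert (Hzx : near z x) by (apply Hx; auto).
        pose proof (near_dist_le V adj G u z x Hzx).
        pose proof (near_dist_le V adj G u x v (near_sym V adj G _ _ Hxv)).
        (* For [k = 0] the truncated [k - 1] does not force [x] to be [u]; in that case [u] itself
           is near all of [A]. *)
        assert (Hc : k = 0 \/ 0 < k) by lia. destruct Hc as [-> | Hc].
        + destruct (Nat.eq_dec (gdist u x) 0) as [E | E].
          * exists x. split; [exact E|]. intros w Hw. apply (near_sym V adj G), Hx. auto.
          * exists u. rewrite gdist_refl. split; auto. intros w [_ Hw].
            apply gdist_near with G; lia.
        + exists x. split; [lia|]. intros w Hw. apply (near_sym V adj G), Hx. auto. }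
    destruct k as [|[|k]].
    - destruct (Hsuff u) as [x [Hx HxA]].
      + rewrite gdist_refl. lia.
      + intros w [_ Hw]. lia.
      + exists x. split; auto. intros w Hw Hdw. apply HxA. split; auto.
    - destruct (Hsuff u) as [x [Hx HxA]].
      + rewrite gdist_refl. lia.
      + intros w [_ Hw]. lia.
      + exists x. split; auto. intros w Hw Hdw. apply HxA. split; auto.
    - set (P := fun y => near v y /\ gdist u y = S (S k)).
      set (below := fun x z => gdist u z = S k /\
             forall w, near x w -> gdist u w <= S (S k) -> near z w).
      assert (Hbelow : forall x, P x -> exists z, below x z).
      { intros x [_ Hx]. destruct (IH (S k) ltac:(lia) x Hx) as [z Hz]. exists z. exact Hz. }
      assert (HPP : forall x x', P x -> P x' ->
                exists y, near x y /\ near x' y /\ gdist u y <= S (S k)).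
      { intros x x' [Hvx Hx] [Hvx' Hx'].
        destruct (classic (near x x')) as [Hn | Hn].
        - exists x. repeat split; auto. lia.
        - destruct (quadrangle_condition u x x' v k) as [y [? [? ?]]]; auto.
          exists y. repeat split; auto. lia. }
      destruct (gdist_pred V adj G u v _ Hv) as [x0 [Hx0 Hdx0]].
      assert (Px0 : P x0) by (split; [now right | auto]).
      destruct (Hbelow x0 Px0) as [z0 Hz0].
      (* A centre [t] is near [v] and near [z0], two levels below [v], so it lies on the level
         between them and belongs to [P]. Quadrangles make the pairwise distances at most two. *)
      destruct (H1 (fun y => y = v \/ P y \/ exists x, P x /\ below x y)) as [t Ht].
      { assert (Hvz : forall x z, P x -> below x z -> gdist v z <= 2).
        { intros x z Px [_ Hz]. assert (near z x) by (apply Hz; auto; destruct Px; lia).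
          destruct Px. eauto using gdist_le_2. }
        assert (Hzx : forall x z x', P x -> below x z -> P x' -> gdist z x' <= 2).
        { intros x z x' Px [_ Hz] Px'. destruct (HPP x x' Px Px') as [y [? [? ?]]].
          eauto using gdist_le_2. }
        intros y y' [-> | [Py | [x [Px Hy]]]] [-> | [Py' | [x' [Px' Hy']]]].
        - rewrite gdist_refl. lia.
        - apply (gdist_le_2 V adj G) with v; auto. destruct Py'. auto.
        - eauto.
        - apply (gdist_le_2 V adj G) with v; auto. destruct Py. auto.
        - destruct Py, Py'. eauto using gdist_le_2.
        - rewrite gdist_sym. eauto.
        - rewrite gdist_sym. eauto.
        - eauto.
        - destruct (HPP x x' Px Px') as [z [? [? ?]]]. destruct Hy, Hy'.
          eauto using gdist_le_2. }
      assert (Pt : P t).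
      { assert (Hvt : near v t) by (apply Ht; auto).
        assert (Hzt : near z0 t) by (apply Ht; eauto).
        pose proof (near_dist_le V adj G u z0 t Hzt).
        pose proof (near_dist_le V adj G u t v (near_sym V adj G _ _ Hvt)).
        destruct Hz0. split; [auto | lia]. }
      destruct (Hbelow t Pt) as [z [Hz Hzdom]].
      assert (HzP : forall y, P y -> near z y).
      { intros y Py. apply Hzdom; [apply (near_sym V adj G), Ht; auto | destruct Py; lia]. }
      destruct (Hsuff z) as [x [Hx HxA]]; [lia| |
        exists x; split; auto; intros w Hw Hdw; apply HxA; split; auto].
      (* A neighbour [w] on the level of [v] has a common lower neighbour with [v] by the triangle
         condition; a lower [w] is in [P] already. Either way a member of [P], hence a neighbour of
         [z], is near [w]. *)
      intros w [Hvw Hw].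
      destruct (Nat.eq_dec (gdist u w) (S (S (S k)))) as [E | E].
      + destruct (classic (v = w)) as [<- | Hne].
        * apply (gdist_le_2 V adj G) with t; [auto | apply Ht; auto].
        * destruct (triangle_condition u v w (S k)) as [y [? [? ?]]]; auto.
          { apply near_adj; auto. }
          apply (gdist_le_2 V adj G) with y; auto. apply HzP. split; auto.
      + pose proof (near_dist_le V adj G u w v (near_sym V adj G _ _ Hvw)).
        apply (gdist_le_2 V adj G) with w; auto. apply HzP. split; auto. lia. }
  intros v Huv. destruct (gdist u v) as [|k] eqn:E.
  { destruct Huv. eapply gdist_0; eauto. }
  destruct (Hind k v E) as [x [Hx Hdom]]. exists x. split; [lia|].
  rewrite E. auto.
Qed.

End OneHellyWeaklyModular.

(** * Consequences of the Helly property *)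

Section HellyConsequences.
Hypothesis HG : Helly_graph V adj.

Lemma Helly_one_Helly : one_Helly V adj.
Proof.
  intros S HS Hint. apply HG; auto. intros A SA. destruct (HS A SA) as [v Hv]. now exists v, 1.
Qed.

(** A vertex near all members of a maximal clique belongs to it, so it is enough to intersect the
    unit balls around the vertices of all the cliques. *)
Lemma Helly_clique_Helly : clique_Helly V adj.
Proof.
  intros S HS Hint. pose proof (proj1 (one_Helly_iff V adj G) Helly_one_Helly) as H1.
  destruct (H1 (fun v => exists C, S C /\ C v)) as [s Hs].
  - intros v w [C [SC Cv]] [D [SD Dw]]. destruct (Hint C D SC SD) as [x [Cx Dx]].
    apply (gdist_le_2 V adj G) with x; [apply (proj1 (clique_near V adj C)) |
      apply (proj1 (clique_near V adj D))]; auto; apply HS; auto.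
  - exists s. intros C SC. destruct (HS C SC) as [Hcl Hmax].
    apply (Hmax (fun x => C x \/ x = s)); auto.
    apply clique_near. intros x y [Cx | ->] [Cy | ->]; auto.
    + now apply (proj1 (clique_near V adj C)).
    + apply Hs. eauto.
    + apply (near_sym V adj G), Hs. eauto.
Qed.

(** The ball of radius [k] around [u] and the unit balls around [A] meet pairwise, the latter in
    [v]. A large [A] yields domination, a pair yields the triangle condition. *)
Lemma Helly_common_lower u v k (A : V -> Prop) : A v ->
  (forall w, A w -> near v w /\ gdist u w <= S k) ->
  exists x, gdist u x <= k /\ forall w, A w -> near x w.
Proof.
  intros Av HA.
  destruct (proj1 (Helly_iff V adj G) HG
     (fun a r => (a = u /\ r = k) \/ (A a /\ r = 1))) as [x Hx].
  - intros a r b t [[-> ->] | [Aa ->]] [[-> ->] | [Ab ->]].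
    + rewrite gdist_refl. lia.
    + apply HA in Ab. lia.
    + apply HA in Aa. rewrite gdist_sym. lia.
    + apply HA in Aa, Ab. apply (gdist_le_2 V adj G) with v; apply (near_sym V adj G); tauto.
  - exists x. split; [apply Hx; auto|]. intros w Aw.
    apply (near_sym V adj G), (gdist_near V adj G), Hx. auto.
Qed.

Lemma Helly_ball_dominated : ball_dominated.
Proof.
  intros u v Huv. destruct (gdist u v) as [|k] eqn:E.
  { destruct Huv. eapply gdist_0; eauto. }
  destruct (Helly_common_lower u v k (fun w => near v w /\ gdist u w <= S k))
    as [x [Hx Hdom]]; auto.
  { split; auto. lia. }
  exists x. split; [lia|]. rewrite E. auto.
Qed.

Lemma Helly_weakly_modular : weakly_modular V adj.
Proof.
  intros u. split.
  - intros v w k Hvw Hk Hv Hw. apply (isdist_iff V adj G) in Hv, Hw.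
    destruct (Helly_common_lower u v (k - 1) (fun y => y = v \/ y = w)) as [x [Hx Hdom]]; auto.
    { intros y [-> | ->]; split; auto; try lia. now right. }
    assert (Hxv : near x v) by auto. assert (Hxw : near x w) by auto.
    pose proof (near_dist_le V adj G u x v Hxv).
    exists x. rewrite (isdist_iff V adj G).
    split; [apply near_adj; auto; intros ->; lia|].
    split; [apply near_adj; auto; intros ->; lia|]. lia.
  - intros v w z k Hvz Hwz Hvw Hk Hv Hw Hz. apply (isdist_iff V adj G) in Hv, Hw, Hz, Hvw.
    (* Here [v] and [w] are at distance two and neither is near the other, so the three balls are
       intersected directly. *)
    destruct (proj1 (Helly_iff V adj G) HG
      (fun a r => (a = u /\ r = k - 1) \/ ((a = v \/ a = w) /\ r = 1))) as [x Hx].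
    + intros a r b t [[-> ->] | [Ha ->]] [[-> ->] | [Hb ->]].
      * rewrite gdist_refl. lia.
      * destruct Hb as [-> | ->]; lia.
      * rewrite gdist_sym. destruct Ha as [-> | ->]; lia.
      * destruct Ha as [-> | ->], Hb as [-> | ->]; rewrite ?gdist_refl; try lia.
        rewrite gdist_sym. lia.
    + assert (Hux : gdist u x <= k - 1) by auto.
      assert (Hxv : near x v) by (apply (near_sym V adj G), (gdist_near V adj G), Hx; auto).
      assert (Hxw : near x w) by (apply (near_sym V adj G), (gdist_near V adj G), Hx; auto).
      pose proof (near_dist_le V adj G u x v Hxv).
      exists x. rewrite (isdist_iff V adj G).
      split; [apply near_adj; auto; intros ->; lia|].
      split; [apply near_adj; auto; intros ->; lia|]. lia.
Qed.

End HellyConsequences.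

(* Order the vertices by distance from a fixed vertex, breaking ties by an arbitrary well-order. *)
Lemma dismantlable_of_ball_dominated : ball_dominated -> dismantlable V adj.
Proof.
  intros HD. destruct (well_order_exists V) as [le (Hr & Ha & Ht & Hto & Hm)].
  destruct nonempty as [u _].
  exists (fun x y => gdist u x < gdist u y \/ (gdist u x = gdist u y /\ le x y)).
  split; [split; [|split; [|split; [|split]]]|].
  - auto.
  - intros x y [H | [H H']] [K | [K K']]; try lia. auto.
  - intros x y z [H | [H H']] [K | [K K']]; try lia. right. split; [lia | eauto].
  - intros x y. destruct (Hto x y); destruct (Nat.lt_trichotomy (gdist u x) (gdist u y))
      as [? | [? | ?]]; auto.
  - intros P [x Px].
    assert (Hmin : exists k, (exists x, P x /\ gdist u x = k) /\
              forall y, P y -> k <= gdist u y).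
    { assert (Hk : exists k x, P x /\ gdist u x = k) by eauto. destruct Hk as [k Hk].
      clear x Px. induction k as [k IH] using (well_founded_induction lt_wf).
      destruct (classic (exists y, P y /\ gdist u y < k)) as [[y [Py Hy]] | Hno].
      - apply (IH (gdist u y)); eauto.
      - exists k. split; auto. intros y Py. apply Nat.nlt_ge. eauto. }
    destruct Hmin as [k [Hk Hlb]].
    destruct (Hm (fun x => P x /\ gdist u x = k) Hk) as [m [[Pm Hdm] Hm']].
    exists m. split; auto. intros y Py. specialize (Hlb y Py).
    destruct (Nat.eq_dec (gdist u y) k); [right; split; auto; lia | left; lia].
  - intros v [w [Hw Hne]].
    destruct (gdist u v) as [|k] eqn:E.
    { destruct Hw as [Hw | [Hw Hl]]; [lia|]. apply gdist_0 in E, Hw. congruence. }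
    destruct (dominator u v k HD E) as [x [Hx [Hvx Hdom]]].
    assert (x <> v) by (intros ->; lia).
    exists x. split; [apply near_adj; auto|]. split; [left; lia|]. split; auto.
    intros y Hy Hyv. apply (near_sym V adj G), Hdom.
    + destruct Hyv as [-> | Hyv]; [auto | right; now apply (adj_sym V adj G)].
    + lia.
Qed.

End Domination.

(** * Covers *)

Section Covers.
Variables (V : Type) (adj : V -> V -> Prop).
Hypothesis G : is_graph V adj.
Local Hint Resolve near_refl near_sym : core.
Notation near := (near V adj).

(* Vertices of the cover are the elements of [M]; [N] is its adjacency-or-equality relation.
   Unit balls of the cover project isomorphically. *)
Record is_cover {T : Type} (M : T -> Prop) (N : T -> T -> Prop) (f : T -> V) : Prop := {
  cover_mem : forall p q, N p q -> M p;
  cover_refl : forall p, M p -> N p p;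
  cover_sym : forall p q, N p q -> N q p;
  cover_near : forall p q, N p q -> near (f p) (f q);
  cover_lift : forall p z, M p -> near (f p) z -> exists q, N p q /\ f q = z;
  cover_reflect : forall p q r, N p q -> N p r -> near (f q) (f r) -> N q r;
  cover_inj : forall p q r, N p q -> N p r -> f q = f r -> q = r }.

(* The combinatorial form of simple connectedness: closed walks lift to closed walks. Only
   covers with vertices in [list V] are tested; the universal cover below is of this kind. *)
Definition covers_split : Prop :=
  forall (M : list V -> Prop) N f, is_cover M N f ->
  forall n (P : nat -> list V), (forall i, i < n -> N (P i) (P (S i))) ->
  f (P n) = f (P 0) -> P n = P 0.

Section Lifting.
Variables (T : Type) (M : T -> Prop) (N : T -> T -> Prop) (f : T -> V).
Hypothesis C : is_cover M N f.

Lemma lift_exists n (x : nat -> V) p : M p -> f p = x 0 ->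
  (forall i, i < n -> near (x i) (x (S i))) ->
  exists P, P 0 = p /\ (forall i, i <= n -> f (P i) = x i) /\
    (forall i, i < n -> N (P i) (P (S i))).
Proof.
  intros Mp Hp. induction n as [|n IH]; intros Hx.
  - exists (fun _ => p). split; [auto|split; [|intros; lia]].
    intros i Hi. replace i with 0 by lia. auto.
  - destruct IH as [P [HP0 [HPf HPN]]]; [auto|].
    assert (MP : M (P n)).
    { destruct n; [congruence|]. apply (cover_mem _ _ _ C _ (P n)).
      apply (cover_sym _ _ _ C). apply HPN. lia. }
    destruct (cover_lift _ _ _ C (P n) (x (S n)) MP) as [q [Hq Hfq]].
    { rewrite HPf; auto. }
    exists (fun i => if Nat.eq_dec i (S n) then q else P i). split; [auto|split].
    + intros i Hi. destruct (Nat.eq_dec i (S n)); [congruence|]. apply HPf. lia.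
    + intros i Hi. destruct (Nat.eq_dec i (S n)); [lia|].
      destruct (Nat.eq_dec (S i) (S n)) as [E|E].
      * replace i with n by lia. auto.
      * apply HPN. lia.
Qed.

(** Diagonals cut the strip between two parallel walks into triangles. Triangles lift because unit
    balls do, so lifts that start side by side stay side by side. *)
Lemma ladder n (P Q : nat -> T) :
  (forall i, i < n -> N (P i) (P (S i))) -> (forall i, i < n -> N (Q i) (Q (S i))) ->
  N (P 0) (Q 0) ->
  (forall i, i < n -> near (f (P i)) (f (Q (S i)))) ->
  (forall i, i < n -> near (f (P (S i))) (f (Q (S i)))) ->
  N (P n) (Q n).
Proof.
  intros HP HQ H0 Hdiag Hrung. induction n as [|n IH]; auto.
  assert (Hn : N (P n) (Q n)) by auto.
  destruct (cover_lift _ _ _ C (P n) (f (Q (S n)))) as [r [Hr Hfr]].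
  { eapply (cover_mem _ _ _ C); eauto. }
  { auto. }
  assert (HPr : N (P n) (Q (S n))).
  { replace (Q (S n)) with r; auto. apply (cover_inj _ _ _ C (Q n)); auto.
    apply (cover_reflect _ _ _ C (P n)); auto. rewrite Hfr. apply (cover_near _ _ _ C). auto. }
  apply (cover_reflect _ _ _ C (P n)); auto.
Qed.

Lemma stationary_lift n (P : nat -> T) :
  (forall i, i < n -> N (P i) (P (S i))) -> (forall i, i <= n -> f (P i) = f (P 0)) ->
  P n = P 0.
Proof.
  intros HP Hf. induction n as [|n IH]; auto.
  assert (E : P n = P 0) by auto. rewrite <- E. assert (H : N (P n) (P (S n))) by auto.
  apply (cover_inj _ _ _ C (P n)); auto.
  - apply (cover_refl _ _ _ C). eapply (cover_mem _ _ _ C); eauto.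
  - rewrite E. auto.
Qed.

(* Pushing the largest vertices of a closed walk to a dominating neighbour moves the
   ends of a lift in parallel. *)
Lemma dismantling_closes_lifts le : well_order V le ->
  (forall v, (exists u, le u v /\ u <> v) ->
     exists w, adj w v /\ le w v /\ w <> v /\
       forall u, le u v -> (u = v \/ adj u v) -> (u = w \/ adj u w)) ->
  forall m n P, (forall i, i < n -> N (P i) (P (S i))) ->
  (forall i, i <= n -> le (f (P i)) m) -> f (P n) = f (P 0) -> P n = P 0.
Proof.
  intros Hle Hdom m. pose proof (well_order_wf V le Hle) as Hwf.
  destruct Hle as (Hr & Ha & Ht & Hto & Hm).
  induction m as [m IH] using (well_founded_induction Hwf).
  intros n P HP HPm Hclosed.
  destruct (classic (exists u, le u m /\ u <> m)) as [Hu | Hno].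
  2:{ apply stationary_lift; auto. intros i Hi.
      assert (Hall : forall j, j <= n -> f (P j) = m).
      { intros j Hj. apply NNPP. intros Hne. apply Hno. eauto. }
      rewrite !Hall; auto. lia. }
  destruct (Hdom m Hu) as [w [Hwm [Hlew [Hne Hw]]]].
  assert (Hw' : forall y, le y m -> near y m -> near y w) by (intros; apply Hw; auto).
  destruct (Nat.eq_dec n 0) as [-> | Hn0]; auto.
  set (push := fun v => if excluded_middle_informative (v = m) then w else v).
  assert (Hpush : forall v, (v = m /\ push v = w) \/ (v <> m /\ push v = v)).
  { intros v. unfold push. destruct (excluded_middle_informative (v = m)); auto. }
  assert (Hwn : near m w) by (right; now apply adj_sym).
  assert (Hstep : forall i, i < n -> near (f (P i)) (f (P (S i)))).
  { intros i Hi. apply (cover_near _ _ _ C). auto. }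
  assert (Hvert : forall v, near v (push v)).
  { intros v. destruct (Hpush v) as [[-> ->] | [_ ->]]; auto. }
  assert (Hdiag : forall y z, le y m -> near y z -> near y (push z)).
  { intros y z Hy Hyz. destruct (Hpush z) as [[-> ->] | [_ ->]]; auto. }
  destruct (cover_lift _ _ _ C (P 0) (push (f (P 0)))) as [q0 [Hq0 Hfq0]].
  { eapply (cover_mem _ _ _ C). apply HP. lia. }
  { auto. }
  destruct (lift_exists n (fun i => push (f (P i))) q0) as [Q [HQ0 [HQf HQ]]].
  { eapply (cover_mem _ _ _ C). apply (cover_sym _ _ _ C). eauto. }
  { auto. }
  { intros i Hi. destruct (Hpush (f (P i))) as [[E ->] | [_ ->]].
    - specialize (Hstep i Hi). rewrite E in Hstep.
      destruct (Hpush (f (P (S i)))) as [[_ ->] | [_ ->]]; [auto|].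
      apply near_sym, Hw'; auto.
    - apply Hdiag; auto. apply HPm. lia. }
  assert (HNn : N (P n) (Q n)).
  { apply ladder; auto.
    - rewrite HQ0. auto.
    - intros i Hi. rewrite HQf by lia. apply Hdiag; auto. apply HPm. lia.
    - intros i Hi. rewrite HQf by lia. auto. }
  (* The pushed walk is finite, so it attains its largest vertex, which is strictly below [m]
     because [m] has been replaced by [w]. *)
  assert (Hmax : forall k, k <= n -> exists j, j <= k /\ forall i, i <= k -> le (f (Q i)) (f (Q j))).
  { induction k as [|k IHk]; intros Hk.
    - exists 0. split; auto. intros i Hi. replace i with 0 by lia. auto.
    - destruct IHk as [j [Hj Hmaxj]]; [lia|].
      destruct (Hto (f (Q (S k))) (f (Q j))) as [Hc | Hc].
      + exists j. split; [lia|]. intros i Hi.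
        destruct (Nat.eq_dec i (S k)) as [-> | E]; auto. apply Hmaxj. lia.
      + exists (S k). split; [lia|]. intros i Hi.
        destruct (Nat.eq_dec i (S k)) as [-> | E]; auto.
        apply Ht with (f (Q j)); auto. apply Hmaxj. lia. }
  destruct (Hmax n (le_n n)) as [j [Hj Hmaxj]].
  assert (HQ0n : Q n = Q 0).
  { apply (IH (f (Q j))); auto.
    - rewrite (HQf j Hj). split.
      + destruct (Hpush (f (P j))) as [[_ ->] | [_ ->]]; auto.
      + destruct (Hpush (f (P j))) as [[_ ->] | [E ->]]; auto.
    - rewrite !HQf; [congruence | lia | lia]. }
  (* [P n] and [P 0] are both near [Q 0 = Q n] and have the same projection. *)
  apply (cover_inj _ _ _ C (Q 0)); auto.
  - apply (cover_sym _ _ _ C). rewrite <- HQ0n. auto.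
  - apply (cover_sym _ _ _ C). rewrite HQ0. auto.
Qed.

End Lifting.

Lemma covers_split_of_dismantlable : dismantlable V adj -> covers_split.
Proof.
  intros [le [Hle Hdom]] M N f C n P HP Hclosed.
  assert (Hmax : forall k, exists m, forall i, i <= k -> le (f (P i)) m).
  { destruct Hle as (Hr & _ & Ht & Hto & _). induction k as [|k [m Hm]].
    - exists (f (P 0)). intros i Hi. replace i with 0 by lia. auto.
    - destruct (Hto (f (P (S k))) m) as [Hc | Hc].
      + exists m. intros i Hi. destruct (Nat.eq_dec i (S k)) as [-> | E]; auto. apply Hm. lia.
      + exists (f (P (S k))). intros i Hi. destruct (Nat.eq_dec i (S k)) as [-> | E]; auto.
        apply Ht with m; auto. apply Hm. lia. }
  destruct (Hmax n) as [m Hm].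
  eapply dismantling_closes_lifts; eauto.
Qed.

End Covers.

(** * The universal cover of a clique-Helly graph *)

Section Tower.
Variables (V : Type) (adj : V -> V -> Prop).
Hypothesis G : is_graph V adj.
Hypothesis HCH : clique_Helly V adj.
Variable u : V.
Local Hint Resolve near_refl near_sym : core.
Notation near := (near V adj).

(* A vertex of the cover is a list: its length is the distance to the base point [nil],
   its head (or [u]) is the projection to the graph. *)
Notation T := (list V).
Notation f p := (hd u p).

(* The ball of radius [k] around the base point of the cover. *)
Record partial_cover (k : nat) (M : T -> Prop) (N : T -> T -> Prop) : Prop := {
  part_nil : M nil;
  part_len : forall p, M p -> length p <= k;
  part_mem : forall p q, N p q -> M p;
  part_refl : forall p, M p -> N p p;
  part_sym : forall p q, N p q -> N q p;
  part_near : forall p q, N p q -> near (f p) (f q);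
  part_level : forall p q, N p q -> length q <= S (length p);
  part_lift : forall p z, M p -> length p < k -> near (f p) z -> exists q, N p q /\ f q = z;
  part_reflect : forall p q r, length p < k -> N p q -> N p r -> near (f q) (f r) -> N q r;
  part_inj : forall p q r, length p < k -> N p q -> N p r -> f q = f r -> q = r;
  part_dom : forall p j, M p -> length p = S j ->
     exists t, M t /\ length t = j /\ forall q, N p q -> length q <= S j -> N t q }.

Section Extension.
Variables (M : T -> Prop) (N : T -> T -> Prop) (k : nat).

Definition missing (z : V) (w : T) : Prop :=
  M w /\ length w = k /\ near (f w) z /\ ~ exists q, N w q /\ f q = z.

Definition linked (z : V) (w w' : T) : Prop := missing z w /\ missing z w' /\ N w w'.

Definition same_parents (z : V) : T -> T -> Prop := clos_refl_trans T (linked z).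

Definition representative (z : V) (w : T) : T :=
  epsilon (inhabits nil) (same_parents z w).

(* New vertices are classes of pairs [(z, w)] under [same_parents z], encoded by a chosen
   representative; [parent p w] says that the old vertex [w] belongs to the class [p]. *)
Definition parent (p w : T) : Prop :=
  exists z, missing z w /\ p = z :: representative z w.

Definition ext_mem (p : T) : Prop := M p \/ exists w, parent p w.

(** New vertices are joined to one another only through a common parent; for [q = p] the last clause
    also provides reflexivity. *)
Definition ext_near (p q : T) : Prop :=
  N p q \/ parent p q \/ parent q p \/
  exists w, parent p w /\ parent q w /\ near (f p) (f q).

Hypothesis PC : partial_cover k M N.

Lemma part_mem_r p q : N p q -> M q.
Proof. intros H. apply (part_mem _ _ _ PC q p), (part_sym _ _ _ PC), H. Qed.

(* On the boundary sphere, pass to the dominator, whose unit ball is complete. *)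
Lemma boundary_reflect p q r : N p q -> N p r -> near (f q) (f r) -> N q r.
Proof.
  intros Hq Hr Hn. pose proof (part_mem _ _ _ PC _ _ Hq) as Mp.
  pose proof (part_len _ _ _ PC _ Mp) as Hp.
  destruct (Nat.eq_dec (length p) k) as [E | E].
  2:{ apply (part_reflect _ _ _ PC p); auto. lia. }
  destruct (Nat.zero_or_succ k) as [Ek | [j Ek]].
  - pose proof (part_len _ _ _ PC _ (part_mem_r _ _ Hq)).
    pose proof (part_len _ _ _ PC _ (part_mem_r _ _ Hr)).
    rewrite Ek in *. destruct q, r; simpl in *; try lia. apply (part_refl _ _ _ PC), PC.
  - destruct (part_dom _ _ _ PC p j Mp ltac:(lia)) as [t [Mt [Ht Hdom]]].
    apply (part_reflect _ _ _ PC t); auto; try lia; apply Hdom; auto;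
      rewrite <- Ek; apply (part_len _ _ _ PC); eapply part_mem_r; eauto.
Qed.

(** A lift of [z] next to [w'] would also be next to [w], by reflection in the unit ball of [w']. An
    interior [w'] does have all its lifts, so [w'] must lie on the boundary sphere. *)
Lemma missing_linked z w w' : missing z w -> N w w' -> near (f w') z -> missing z w'.
Proof.
  intros (Mw & Hw & Hwz & Hno) Hww' Hw'z.
  assert (Hblock : forall q, N w' q -> f q = z -> False).
  { intros q Hq Hfq. apply Hno. exists q. split; auto.
    apply boundary_reflect with w'; auto.
    - apply (part_sym _ _ _ PC). auto.
    - rewrite Hfq. auto. }
  pose proof (part_mem_r _ _ Hww') as Mw'.
  pose proof (part_len _ _ _ PC _ Mw') as Hlen.
  split; auto. split; [|split; auto].
  - destruct (Nat.eq_dec (length w') k); auto.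
    destruct (part_lift _ _ _ PC w' z) as [q [Hq Hfq]]; auto; [lia|].
    destruct (Hblock q Hq Hfq).
  - intros [q [Hq Hfq]]. eauto.
Qed.

Lemma same_parents_sym z w w' : same_parents z w w' -> same_parents z w' w.
Proof.
  induction 1 as [w w' (H1 & H2 & H3) | | w1 w2 w3 _ IH1 _ IH2].
  - apply rt_step. split; [|split]; auto. apply (part_sym _ _ _ PC), H3.
  - apply rt_refl.
  - eapply rt_trans; eauto.
Qed.

(** Equivalent vertices have extensionally equal classes, hence equal class predicates, and
    [epsilon] depends on the predicate alone. *)
Lemma representative_eq z w w' : same_parents z w w' ->
  representative z w = representative z w'.
Proof.
  intros H. unfold representative. f_equal. extensionality x.
  apply propositional_extensionality. split; intros Hx.
  - eapply rt_trans; [apply same_parents_sym|]; eauto.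
  - eapply rt_trans; eauto.
Qed.

Lemma representative_spec z w : same_parents z w (representative z w).
Proof. unfold representative. apply epsilon_spec. exists w. apply rt_refl. Qed.

Lemma parent_linked p w w' : parent p w -> N w w' -> near (f w') (f p) -> parent p w'.
Proof.
  intros [z [Hw ->]] Hww' Hn. simpl in Hn. pose proof (missing_linked z w w' Hw Hww' Hn) as Hw'.
  exists z. split; auto. f_equal. apply representative_eq, rt_step. split; auto.
Qed.

Lemma parent_missing p w : parent p w -> missing (f p) w.
Proof. intros [z [H ->]]. exact H. Qed.

Lemma parent_same p w w' : parent p w -> parent p w' -> same_parents (f p) w w'.
Proof.
  intros [z [H ->]] [z' [H' E]]. injection E as <- E. simpl.
  eapply rt_trans; [apply representative_spec|]. rewrite E.
  apply same_parents_sym, representative_spec.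
Qed.

(** A chain of links never leaves the sphere of radius [k], so the chosen representative has length
    [k]; this keeps list length equal to level. *)
Lemma parent_length p w : parent p w -> length p = S k.
Proof.
  intros [z [H ->]]. simpl. f_equal.
  pose proof (representative_spec z w) as Hs. destruct H as (_ & H & _).
  revert H. generalize (representative z w) Hs. clear Hs.
  induction 1 as [a b (H1 & H2 & _) | | a b c _ IH1 _ IH2]; auto.
  intros _. apply H2.
Qed.

Lemma parent_unique p q w : parent p w -> parent q w -> f p = f q -> p = q.
Proof. intros [z [_ ->]] [z' [_ ->]]. simpl. now intros ->. Qed.

Lemma parent_near p w : parent p w -> near (f w) (f p).
Proof. intros H. apply parent_missing in H. apply H. Qed.

Lemma parent_mem p w : parent p w -> M w /\ length w = k.
Proof. intros H. apply parent_missing in H. split; apply H. Qed.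

Lemma parent_no_lift p w q : parent p w -> N w q -> f q <> f p.
Proof. intros H Hq E. apply parent_missing in H. apply H. eauto. Qed.

(** Domination seen from [p]. A neighbour of [p] on its own level shares some parent [w] with [p],
    so a parent absorbing all parents of [p] is near every such neighbour. *)
Definition absorbs (p s w : T) : Prop :=
  N s w /\ forall y, near y (f p) -> near y (f w) -> near y (f s).

(* The cliques [f K] and [{f p, f w}], for [w] in [K], pairwise intersect. Their centre is
   not [f p] itself because it is adjacent to the image of a vertex below [K]. *)
Lemma clique_absorbed j p (K : T -> Prop) w0 : k = S j -> K w0 ->
  (forall w, K w -> parent p w) -> (forall w w', K w -> K w' -> N w w') ->
  exists s, parent p s /\ forall w, K w -> absorbs p s w.
Proof.
  intros Ek Kw0 HKp HKN.
  destruct (clique_Helly_center V adj G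
    (fun C => C = (fun y => exists w, K w /\ y = f w) \/
       exists w, K w /\ C = (fun y => y = f p \/ y = f w)) HCH) as [s Hs].
  { assert (Hfp : forall w, K w -> near (f w) (f p)).
    { intros w Kw. apply parent_near, HKp, Kw. }
    intros C [-> | [w [Kw ->]]] x y.
    - intros [a [Ka ->]] [b [Kb ->]]. apply (part_near _ _ _ PC). auto.
    - intros [-> | ->] [-> | ->]; auto. }
  { intros C C' [-> | [w [Kw ->]]] [-> | [w' [Kw' ->]]].
    - exists (f w0). split; eauto.
    - exists (f w'). split; eauto.
    - exists (f w). split; eauto.
    - exists (f p). auto. }
  assert (Hs1 : forall y, (forall w, K w -> near (f w) y) -> near s y).
  { intros y Hy. apply (Hs _ y (or_introl eq_refl)). intros x [w [Kw ->]]. auto. }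
  assert (Hs2 : forall w y, K w -> near (f p) y -> near (f w) y -> near s y).
  { intros w y Kw Hp Hw. eapply Hs; [right; exists w; split; [exact Kw | reflexivity]|].
    intros x [-> | ->]; auto. }
  destruct (parent_mem p w0 (HKp _ Kw0)) as [Mw0 Hw0].
  destruct (part_dom _ _ _ PC w0 j Mw0 ltac:(lia)) as [x [Mx [Hx Hdom]]].
  assert (HxK : forall w, K w -> N x w).
  { intros w Kw. apply Hdom; auto. destruct (parent_mem p w (HKp _ Kw)). lia. }
  (* The vertex [x] is interior, so the centre lifts next to it. The lift is near all of [K] and its
     image is near [f p], hence it is again a parent of [p]. *)
  destruct (part_lift _ _ _ PC x s) as [s' [Hxs' <-]]; auto; [lia| |].
  { apply near_sym; auto. apply Hs1. intros w Kw. apply near_sym; auto.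
    apply (part_near _ _ _ PC). auto. }
  assert (Hws : forall w, K w -> N w s').
  { intros w Kw. apply (part_reflect _ _ _ PC x); auto; [lia|].
    apply near_sym; auto. apply (Hs2 w); auto.
    apply near_sym; auto. apply parent_near. auto. }
  assert (Hsp : near (f s') (f p)).
  { apply (Hs2 w0); auto. apply parent_near. auto. }
  exists s'. split.
  - apply (parent_linked p w0); auto.
  - intros w Kw. split; [apply (part_sym _ _ _ PC); auto|].
    intros y Hyp Hyw. apply near_sym; auto. apply (Hs2 w); auto.
Qed.

(* The dominator of a maximal clique of parents already dominates all of them:
   a larger dominator would belong to the same clique. *)
Lemma dominating_parent p w0 : parent p w0 ->
  exists t, parent p t /\ forall w, parent p w -> absorbs p t w.
Proof.
  intros Hw0. destruct (Nat.zero_or_succ k) as [Ek | [j Ek]].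
  { exists w0. split; auto. intros w Hw.
    assert (E : forall v, parent p v -> v = nil).
    { intros v Hv. destruct (parent_mem p v Hv) as [_ Hl]. rewrite Ek in Hl.
      now destruct v. }
    rewrite (E w Hw), (E w0 Hw0). split; auto. apply (part_refl _ _ _ PC), PC. }
  destruct (maximal_clique_extension {w | parent p w} (fun a b => N (proj1_sig a) (proj1_sig b))
     (fun a => proj1_sig a = w0)) as [K0 [HK1 [HK2 HK3]]].
  { intros [a Ha]. simpl. apply (part_refl _ _ _ PC). now apply parent_mem in Ha. }
  { intros a b. apply (part_sym _ _ _ PC). }
  { intros a b -> ->. apply (part_refl _ _ _ PC). now apply parent_mem in Hw0. }
  set (K := fun w => exists H : parent p w, K0 (exist _ w H)).
  assert (Kw0 : K w0) by (exists Hw0; auto).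
  assert (HKp : forall w, K w -> parent p w) by (now intros w [H _]).
  assert (HKN : forall w w', K w -> K w' -> N w w').
  { intros w w' [H Kw] [H' Kw']. exact (HK2 _ _ Kw Kw'). }
  assert (HKmax : forall s, parent p s -> (forall w, K w -> N s w) -> K s).
  { intros s Hs Hsw. exists Hs. apply HK3. intros [w Hw] Kw. simpl. apply Hsw. now exists Hw. }
  clearbody K. clear K0 HK1 HK2 HK3.
  destruct (clique_absorbed j p K w0) as [t [Ht Habs]]; auto.
  assert (Kt : K t).
  { apply HKmax; auto. intros w Kw. apply (Habs w Kw). }
  (* A parent [s] absorbing both [t] and [a] is near all of [K], since [K] is near [t]; by
     maximality [s] is in [K]. Now [t] absorbs [s], which absorbs [a]. *)
  assert (Hadj : forall a, parent p a -> N t a -> absorbs p t a).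
  { intros a Ha Hta.
    destruct (clique_absorbed j p (fun w => w = t \/ w = a) t) as [s [Hs Hsabs]]; auto.
    { intros w [-> | ->]; auto. }
    { pose proof (proj1 (parent_mem p t Ht)). pose proof (proj1 (parent_mem p a Ha)).
      intros w w' [-> | ->] [-> | ->]; auto; try (apply (part_refl _ _ _ PC); auto).
      apply (part_sym _ _ _ PC). auto. }
    destruct (Hsabs t) as [Hst Hst']; auto. destruct (Hsabs a) as [Hsa Hsa']; auto.
    assert (Ks : K s).
    { apply HKmax; auto. intros w Kw. apply (part_sym _ _ _ PC).
      apply (boundary_reflect t); auto.
      - apply (part_sym _ _ _ PC). auto.
      - apply Hst'; [apply parent_near; auto|].
        apply (part_near _ _ _ PC). auto. }
    split; auto. intros y Hyp Hya. apply (Habs s Ks); auto. }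
  exists t. split; auto. intros w Hw.
  pose proof (parent_same p t w Ht Hw) as Hc. clear Hw.
  (* Induction along a chain of parents from [t] to [w]: once [t] absorbs [a], the next member [b],
     near [a] and over a neighbour of [f p], is near [t], and [Hadj] applies to it. *)
  apply clos_rt_rtn1 in Hc.
  induction Hc as [|a b (Ha & Hb & Hab) Hc IH].
  - apply Hadj; auto.
  - assert (Pa : parent p a).
    { destruct Ht as [z [Hz E]]. simpl in *. exists z.
      assert (Ez : f p = z) by now rewrite E. rewrite Ez in *. split; auto. rewrite E. f_equal.
      apply representative_eq. apply clos_rtn1_rt. exact Hc. }
    assert (Pb : parent p b).
    { apply (parent_linked p a); auto. apply Hb. }
    destruct IH as [Hta Hta'].
    apply Hadj; auto. apply (boundary_reflect a); auto.
    + apply (part_sym _ _ _ PC). auto.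
    + apply near_sym; auto. apply Hta'; [apply parent_near; auto|].
      apply near_sym; auto. apply (part_near _ _ _ PC). auto.
Qed.

Lemma ext_old p q : length p <= k -> ext_near p q -> M p /\ (N p q \/ parent q p).
Proof.
  intros Hp [H | [H | [H | [w [H _]]]]].
  - split; auto. eapply part_mem; eauto.
  - apply parent_length in H. lia.
  - split; auto. now apply (parent_mem q p).
  - apply parent_length in H. lia.
Qed.

Lemma ext_old_old p q : length p <= k -> length q <= k -> ext_near p q -> N p q.
Proof.
  intros Hp Hq H. apply ext_old in H as [_ [H | H]]; auto.
  apply parent_length in H. lia.
Qed.

Lemma ext_mem_old p : length p <= k -> ext_mem p -> M p.
Proof. intros Hp [H | [w H]]; auto. apply parent_length in H. lia. Qed.

Lemma ext_mem_len p : ext_mem p -> length p <= S k.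
Proof.
  intros [H | [w H]].
  - apply (part_len _ _ _ PC) in H. lia.
  - apply parent_length in H. lia.
Qed.

Lemma ext_near_sym p q : ext_near p q -> ext_near q p.
Proof.
  intros [H | [H | [H | [w [H1 [H2 H3]]]]]].
  - left. now apply (part_sym _ _ _ PC).
  - right. right. now left.
  - right. now left.
  - right. right. right. exists w. auto.
Qed.

Lemma ext_reflect p q r : length p <= k -> ext_near p q -> ext_near p r ->
  near (f q) (f r) -> ext_near q r.
Proof.
  intros Hp Hq Hr Hn. apply ext_old in Hq as [_ Hq]; auto. apply ext_old in Hr as [_ Hr]; auto.
  destruct Hq as [Hq | Hq], Hr as [Hr | Hr].
  - left. apply boundary_reflect with p; auto.
  - right. right. left. apply (parent_linked r p); auto.
  - right. left. apply (parent_linked q p); auto.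
  - right. right. right. exists p. auto.
Qed.

Lemma ext_inj p q r : length p <= k -> ext_near p q -> ext_near p r -> f q = f r -> q = r.
Proof.
  intros Hp Hq Hr E. apply ext_old in Hq as [Mp Hq]; auto. apply ext_old in Hr as [_ Hr]; auto.
  destruct Hq as [Hq | Hq], Hr as [Hr | Hr].
  - destruct (Nat.eq_dec (length p) k) as [Ep | Ep].
    2:{ apply (part_inj _ _ _ PC p); auto. lia. }
    destruct (Nat.zero_or_succ k) as [Ek | [j Ek]].
    + pose proof (part_len _ _ _ PC _ (part_mem_r _ _ Hq)).
      pose proof (part_len _ _ _ PC _ (part_mem_r _ _ Hr)).
      rewrite Ek in *. destruct q, r; simpl in *; try lia. auto.
    + destruct (part_dom _ _ _ PC p j Mp ltac:(lia)) as [t [Mt [Ht Hdom]]].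
      apply (part_inj _ _ _ PC t); auto; try lia; apply Hdom; auto; rewrite <- Ek;
        apply (part_len _ _ _ PC); eapply part_mem_r; eauto.
  - destruct (parent_no_lift r p q); auto.
  - destruct (parent_no_lift q p r); auto.
  - apply (parent_unique q r p); auto.
Qed.

Lemma extension : partial_cover (S k) ext_mem ext_near.
Proof.
  split.
  - left. apply PC.
  - exact ext_mem_len.
  - intros p q [H | [H | [H | [w [H _]]]]].
    + left. eapply part_mem; eauto.
    + right. eauto.
    + left. apply (parent_mem q p H).
    + right. eauto.
  - intros p [H | [w H]].
    + left. now apply (part_refl _ _ _ PC).
    + right. right. right. exists w. auto.
  - exact ext_near_sym.
  - intros p q [H | [H | [H | [w [_ [_ H]]]]]]; auto.
    + now apply (part_near _ _ _ PC).
    + apply near_sym; auto. now apply parent_near.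
    + now apply parent_near.
  - intros p q [H | [H | [H | [w [H [H' _]]]]]].
    + now apply (part_level _ _ _ PC).
    + pose proof (parent_length _ _ H). destruct (parent_mem _ _ H). lia.
    + pose proof (parent_length _ _ H). destruct (parent_mem _ _ H). lia.
    + rewrite (parent_length _ _ H), (parent_length _ _ H'). lia.
  - intros p z Hp Hlen Hn. apply ext_mem_old in Hp; [|lia].
    destruct (classic (exists q, N p q /\ f q = z)) as [[q [Hq Hfq]] | Hno].
    { exists q. split; auto. now left. }
    destruct (Nat.eq_dec (length p) k) as [E | E].
    + exists (z :: representative z p). split; auto. right. right. left.
      exists z. split; auto. split; auto.
    + destruct (part_lift _ _ _ PC p z) as [q [Hq Hfq]]; auto; [lia|]. destruct Hno. eauto.
  - intros p q r Hp. apply ext_reflect. lia.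
  - intros p q r Hp. apply ext_inj. lia.
  - intros p j Hp Hlen. destruct Hp as [Hp | [w0 Hw0]].
    + pose proof (part_len _ _ _ PC p Hp).
      destruct (part_dom _ _ _ PC p j Hp Hlen) as [t [Mt [Ht Hdom]]].
      exists t. split; [now left|]. split; auto. intros q Hq Hql. left. apply Hdom; auto.
      apply ext_old_old; auto; lia.
    + pose proof (parent_length p w0 Hw0).
      destruct (dominating_parent p w0 Hw0) as [t [Ht Hdom]].
      destruct (parent_mem p t Ht) as [Mt Hlt].
      exists t. split; [now left|]. split; [lia|]. intros q Hq Hql.
      destruct Hq as [Hq | [Hq | [Hq | [w [Hpw [Hqw Hpq]]]]]].
      * apply (part_mem _ _ _ PC), (part_len _ _ _ PC) in Hq. lia.
      * left. apply (Hdom q Hq).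
      * destruct (parent_mem q p Hq). lia.
      (* [q] is a new vertex sharing the parent [w] with [p]. Absorption gives nearness of the
         projections, which reflects in the unit ball of [w]. *)
      * destruct (Hdom w Hpw) as [Htw Htw'].
        destruct (parent_mem p w Hpw) as [_ Hlw].
        apply (ext_reflect w).
        -- lia.
        -- left. now apply (part_sym _ _ _ PC).
        -- right. right. now left.
        -- apply near_sym; auto. apply Htw'; auto. apply near_sym; auto.
           now apply parent_near.
Qed.

End Extension.

(** * The union of the stages *)

Fixpoint tower (k : nat) : (T -> Prop) * (T -> T -> Prop) :=
  match k with
  | 0 => (fun p => p = nil, fun p q => p = nil /\ q = nil)
  | S k => (ext_mem (fst (tower k)) (snd (tower k)) k,
            ext_near (fst (tower k)) (snd (tower k)) k)
  end.

Lemma tower_partial_cover k : partial_cover k (fst (tower k)) (snd (tower k)).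
Proof.
  induction k as [|k IH]; [|now apply extension].
  simpl. split; try (intros; simpl in *; lia).
  - reflexivity.
  - now intros p ->.
  - now intros p q [-> _].
  - now intros p ->.
  - intros p q [-> ->]. auto.
  - intros p q [-> ->]. auto.
  - intros p q [-> ->]. simpl. lia.
  - intros p j -> E. discriminate.
Qed.

Definition total_mem (p : T) : Prop := exists k, fst (tower k) p.
Definition total_near (p q : T) : Prop := exists k, snd (tower k) p q.

Lemma tower_mono k j : k <= j ->
  (forall p, fst (tower k) p -> fst (tower j) p) /\
  (forall p q, snd (tower k) p q -> snd (tower j) p q).
Proof.
  induction 1 as [|j Hj [IH1 IH2]]; auto. split; intros; left; auto.
Qed.

Lemma tower_stable k j p q : k <= j -> snd (tower j) p q ->
  length p <= k -> length q <= k -> snd (tower k) p q.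
Proof.
  induction 1 as [|j Hj IH]; auto. intros H Hp Hq. apply IH; auto.
  eapply (ext_old_old _ _ _ (tower_partial_cover j)); try lia. exact H.
Qed.

Lemma total_common p q r : total_near p q -> total_near p r ->
  exists k, length p < k /\ snd (tower k) p q /\ snd (tower k) p r.
Proof.
  intros [i Hi] [j Hj]. exists (i + j + S (length p)). split; [lia|].
  split; [apply (tower_mono i) | apply (tower_mono j)]; auto; lia.
Qed.

Lemma total_cover : is_cover V adj total_mem total_near (fun p => f p).
Proof.
  split.
  - intros p q [k H]. exists k. eapply part_mem; eauto using tower_partial_cover.
  - intros p [k H]. exists k. eapply part_refl; eauto using tower_partial_cover.
  - intros p q [k H]. exists k. eapply part_sym; eauto using tower_partial_cover.
  - intros p q [k H]. eapply part_near; eauto using tower_partial_cover.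
  - intros p z [k H] Hz.
    destruct (part_lift _ _ _ (tower_partial_cover (k + S (length p))) p z) as [q [Hq Hfq]]; auto.
    + apply (tower_mono k); auto. lia.
    + lia.
    + exists q. split; auto. eexists; eauto.
  - intros p q r Hq Hr Hn. destruct (total_common p q r Hq Hr) as [k [Hk [Hq' Hr']]].
    exists k. eapply (part_reflect _ _ _ (tower_partial_cover k)); eauto.
  - intros p q r Hq Hr E. destruct (total_common p q r Hq Hr) as [k [Hk [Hq' Hr']]].
    eapply (part_inj _ _ _ (tower_partial_cover k)); eauto.
Qed.

Lemma total_level p q : total_near p q -> length q <= S (length p).
Proof. intros [k H]. eapply part_level; eauto using tower_partial_cover. Qed.

Lemma total_dom p j : total_mem p -> length p = S j ->
  exists t, total_mem t /\ length t = j /\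
    forall q, total_near p q -> length q <= S j -> total_near t q.
Proof.
  intros [k Hk] Hp. assert (Mp : fst (tower (S j)) p).
  { destruct (Nat.le_gt_cases k (S j)); [now apply (tower_mono k)|].
    assert (Hle : S j <= k) by lia. clear H. revert Hk. induction Hle as [|k Hle IH]; auto.
    intros H. apply IH. eapply (ext_mem_old _ _ k); [lia | exact H]. }
  destruct (part_dom _ _ _ (tower_partial_cover (S j)) p j Mp Hp) as [t [Mt [Ht Hdom]]].
  exists t. split; [now exists (S j)|]. split; auto. intros q [i Hq] Hlq.
  exists (S j). apply Hdom; auto.
  apply (tower_stable (S j) (i + S j)); try lia. apply (tower_mono i); auto. lia.
Qed.

Notation dist := (gdist V adj G).

Lemma total_dist_le j : forall p, total_mem p -> length p = j -> dist u (f p) <= j.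
Proof.
  induction j as [|j IH]; intros p Hp Hlen.
  - destruct p; [|discriminate]. simpl. now rewrite gdist_refl.
  - destruct (total_dom p j Hp Hlen) as [t [Mt [Ht Hdom]]].
    assert (Htp : near (f t) (f p)).
    { apply (cover_near V adj _ _ _ total_cover), Hdom; [|lia].
      now apply (cover_refl V adj _ _ _ total_cover). }
    pose proof (near_dist_le V adj G u _ _ Htp). specialize (IH t Mt Ht). lia.
Qed.

Lemma total_path j : forall p, total_mem p -> length p = j ->
  exists P : nat -> T, P 0 = nil /\ P j = p /\ forall i, i < j -> total_near (P i) (P (S i)).
Proof.
  induction j as [|j IH]; intros p Hp Hlen.
  - destruct p; [|discriminate]. exists (fun _ => nil). repeat split. intros; lia.
  - destruct (total_dom p j Hp Hlen) as [t [Mt [Ht Hdom]]].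
    assert (Htp : total_near t p).
    { apply Hdom; [|lia]. now apply (cover_refl V adj _ _ _ total_cover). }
    destruct (IH t Mt Ht) as [P [HP0 [HPj HP]]].
    exists (fun i => if Nat.eq_dec i (S j) then p else P i). split; [auto|].
    split; [now destruct (Nat.eq_dec (S j) (S j))|].
    intros i Hi. destruct (Nat.eq_dec i (S j)); [lia|].
    destruct (Nat.eq_dec (S i) (S j)) as [E | E]; [|apply HP; lia].
    replace i with j by lia. now rewrite HPj.
Qed.

Hypothesis SC : covers_split V adj.

(** A path from [p] back to [nil], continued by one from [nil] to [q], projects to a closed walk,
    which must lift to a closed one. *)
Lemma total_inj p q : total_mem p -> total_mem q -> f p = f q -> p = q.
Proof.
  intros Mp Mq E. destruct (total_path (length p) p Mp eq_refl) as [P [HP0 [HPp HP]]].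
  destruct (total_path (length q) q Mq eq_refl) as [Q [HQ0 [HQq HQ]]].
  set (a := length p) in *. set (b := length q) in *.
  set (W := fun i => if le_lt_dec i a then P (a - i) else Q (i - a)).
  assert (HW : W (a + b) = W 0).
  { apply (SC _ _ _ total_cover).
    - intros i Hi. unfold W. destruct (le_lt_dec i a), (le_lt_dec (S i) a).
      + apply (cover_sym V adj _ _ _ total_cover).
        replace (a - i) with (S (a - S i)) by lia. apply HP. lia.
      + replace (a - i) with 0 by lia. rewrite HP0, <- HQ0.
        replace (S i - a) with 1 by lia. apply HQ. lia.
      + lia.
      + replace (S i - a) with (S (i - a)) by lia. apply HQ. lia.
    - unfold W. destruct (le_lt_dec 0 a); [|lia]. replace (a - 0) with a by lia. rewrite HPp.
      destruct (le_lt_dec (a + b) a).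
      + assert (b = 0) by lia. replace (a - (a + b)) with 0 by lia. rewrite HP0, <- HQ0.
        replace 0 with b by lia. now rewrite HQq.
      + replace (a + b - a) with b by lia. now rewrite HQq. }
  unfold W in HW. destruct (le_lt_dec 0 a); [|lia]. replace (a - 0) with a in HW by lia.
  rewrite HPp in HW. rewrite <- HW.
  destruct (le_lt_dec (a + b) a).
  - assert (b = 0) by lia. replace (a - (a + b)) with 0 by lia. rewrite HP0, <- HQ0.
    replace 0 with b by lia. auto.
  - replace (a + b - a) with b by lia. auto.
Qed.

Lemma total_lift k : forall v, dist u v = k -> exists p, total_mem p /\ f p = v /\ length p <= k.
Proof.
  induction k as [|k IH]; intros v Hv.
  - apply gdist_0 in Hv as <-. exists nil. split; [now exists 0|]. split; auto.
  - destruct (gdist_pred V adj G u v k Hv) as [w [Hvw Hw]].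
    destruct (IH w Hw) as [q [Mq [Hfq Hlq]]].
    destruct (cover_lift V adj _ _ _ total_cover q v Mq) as [p [Hp Hfp]].
    { rewrite Hfq. right. now apply (adj_sym V adj G). }
    exists p. split; [|split; auto].
    + eapply (cover_mem V adj _ _ _ total_cover).
      apply (cover_sym V adj _ _ _ total_cover). eauto.
    + pose proof (total_level q p Hp). lia.
Qed.

(** A geodesic from [u] lifts to a vertex over [f p] of level at most the distance; by injectivity
    that vertex is [p]. *)
Lemma total_length p : total_mem p -> length p = dist u (f p).
Proof.
  intros Mp. destruct (total_lift _ (f p) eq_refl) as [q [Mq [Hq Hlq]]].
  rewrite (total_inj q p Mq Mp Hq) in Hlq.
  pose proof (total_dist_le _ p Mp eq_refl). lia.
Qed.

Lemma dominated_from_base v : u <> v -> exists x, dominates_toward V adj G u v x.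
Proof.
  intros Huv. destruct (dist u v) as [|j] eqn:E.
  { destruct Huv. eapply gdist_0; eauto. }
  destruct (total_lift _ v E) as [p [Mp [Hfp _]]].
  pose proof (total_length p Mp) as Hlp. rewrite Hfp, E in Hlp.
  destruct (total_dom p j Mp Hlp) as [t [Mt [Ht Hdom]]].
  exists (f t). split; rewrite E.
  - rewrite <- (total_length t Mt). lia.
  - intros w Hvw Hw. rewrite <- Hfp in Hvw.
    destruct (cover_lift V adj _ _ _ total_cover p w Mp Hvw) as [q [Hq <-]].
    apply (cover_near V adj _ _ _ total_cover), Hdom; auto.
    rewrite (total_length q); auto. eapply (cover_mem V adj _ _ _ total_cover).
    apply (cover_sym V adj _ _ _ total_cover). eauto.
Qed.

End Tower.

Lemma ball_dominated_of_covers_split (V : Type) (adj : V -> V -> Prop) (G : is_graph V adj) :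
  clique_Helly V adj -> covers_split V adj -> ball_dominated V adj G.
Proof. intros HCH SC u v. now apply dominated_from_base. Qed.

(** * Points of the clique complex *)

Open Scope R_scope.

(** Compactness of an interval in the form of Cousin's lemma: the supremum of the points reachable
    from [lo] can be neither missed nor passed short of [hi]. It stands in for finite subcovers
    throughout. *)
Lemma interval_induction (lo hi : R) (Q : R -> R -> Prop) : lo <= hi ->
  (forall a b c, a <= b <= c -> Q a b -> Q b c -> Q a c) ->
  (forall x, lo <= x <= hi -> exists e, 0 < e /\
     forall a b, lo <= a <= x -> x <= b <= hi -> x - e < a -> b < x + e -> Q a b) ->
  Q lo hi.
Proof.
  intros Hlh Htrans Hloc.
  destruct (completeness (fun x => lo <= x <= hi /\ Q lo x)) as [s [Hub Hlub]].
  - exists hi. intros x [[_ Hx] _]. exact Hx.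
  - exists lo. split; [lra|]. destruct (Hloc lo) as [e [He Hq]]; [lra|]. apply Hq; lra.
  - assert (Hlo : lo <= s).
    { apply Hub. split; [lra|]. destruct (Hloc lo) as [e [He Hq]]; [lra|]. apply Hq; lra. }
    assert (Hhi : s <= hi) by (apply Hlub; intros x [[_ Hx] _]; exact Hx).
    destruct (Hloc s (conj Hlo Hhi)) as [e [He Hq]].
    assert (Hx : exists x, (lo <= x <= hi /\ Q lo x) /\ s - e < x).
    { apply NNPP. intros Hno. assert (Hb : s <= s - e); [|lra].
      apply Hlub. intros x Hx. apply Rnot_lt_le. intros Hlt. apply Hno. eauto. }
    destruct Hx as [x [[Hx Qx] Hsx]].
    assert (Hxs : x <= s) by (apply Hub; auto).
    assert (Qs : forall b, s <= b <= hi -> b < s + e -> Q lo b).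
    { intros b Hb Hbe. apply Htrans with x; [lra | auto |]. apply Hq; lra. }
    destruct (Rle_lt_dec (s + e / 2) hi) as [Hc | Hc].
    + assert (s + e / 2 <= s); [|lra]. apply Hub. split; [lra|]. apply Qs; lra.
    + apply Qs; lra.
Qed.

Definition clamp (r : R) : R := Rmax 0 (Rmin 1 r).

Lemma clamp_cases r :
  (r <= 0 /\ clamp r = 0) \/ (0 <= r <= 1 /\ clamp r = r) \/ (1 <= r /\ clamp r = 1).
Proof.
  unfold clamp, Rmax, Rmin. destruct (Rle_dec 1 r); destruct (Rle_dec 0 _); lra.
Qed.

Lemma clamp_bounds r : 0 <= clamp r <= 1.
Proof. destruct (clamp_cases r) as [H | [H | H]]; lra. Qed.

(* [B d] is the ball of radius [d] around a point of a parameter space [Z]. *)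
Section Limits.
Variables (Z : Type) (B : R -> Z -> Prop).
Hypothesis B_mono : forall d e z, d <= e -> B d z -> B e z.

Definition ultimately (P : Z -> Prop) : Prop :=
  exists d, 0 < d /\ forall z, B d z -> P z.

Definition tends (h : Z -> R) (L : R) : Prop :=
  forall e, 0 < e -> ultimately (fun z => Rabs (h z - L) < e).

Lemma ultimately_and P Q : ultimately P -> ultimately Q -> ultimately (fun z => P z /\ Q z).
Proof.
  intros [d [Hd HP]] [e [He HQ]]. exists (Rmin d e).
  split; [now apply Rmin_glb_lt|]. intros z Hz. split.
  - apply HP, B_mono with (Rmin d e); auto. apply Rmin_l.
  - apply HQ, B_mono with (Rmin d e); auto. apply Rmin_r.
Qed.

Lemma ultimately_imp (P Q : Z -> Prop) : (forall z, P z -> Q z) -> ultimately P -> ultimately Q.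
Proof. intros H [d [Hd HP]]. exists d. auto. Qed.

Lemma ultimately_list {A} (P : A -> Z -> Prop) (l : list A) :
  (forall a, In a l -> ultimately (P a)) -> ultimately (fun z => forall a, In a l -> P a z).
Proof.
  induction l as [|a l IH]; intros H.
  - exists 1. split; [lra|]. intros z _ a [].
  - eapply ultimately_imp; [|apply ultimately_and; [apply (H a) | apply IH]].
    + intros z [H1 H2] b [<- | Hb]; auto.
    + now left.
    + intros b Hb. apply H. now right.
Qed.

Lemma tends_const c : tends (fun _ => c) c.
Proof.
  intros e He. exists 1. split; [lra|]. intros z _. now rewrite Rminus_diag, Rabs_R0.
Qed.

Lemma tends_plus h k L M : tends h L -> tends k M -> tends (fun z => h z + k z) (L + M).
Proof.
  intros Hh Hk e He.
  eapply ultimately_imp; [|apply ultimately_and; [apply (Hh (e / 2)) | apply (Hk (e / 2))]]; try lra.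
  intros z [H1 H2]. replace (h z + k z - (L + M)) with ((h z - L) + (k z - M)) by ring.
  eapply Rle_lt_trans; [apply Rabs_triang|]. lra.
Qed.

Lemma tends_mult h k L M : tends h L -> tends k M -> tends (fun z => h z * k z) (L * M).
Proof.
  intros Hh Hk e He.
  set (b := 1 + Rabs L + Rabs M).
  assert (Hb : 1 <= b) by (unfold b; pose proof (Rabs_pos L); pose proof (Rabs_pos M); lra).
  (* With both errors below [d <= 1], their product is below [d], and the total error is below
     [d * b <= e]. *)
  set (d := Rmin 1 (e / b)).
  assert (Hd : 0 < d) by (apply Rmin_glb_lt; [lra | apply Rdiv_lt_0_compat; lra]).
  assert (Hd1 : d <= 1) by apply Rmin_l.
  assert (Hdb : d * b <= e).
  { apply Rle_trans with (e / b * b).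
    - apply Rmult_le_compat_r; [lra | apply Rmin_r].
    - right. field. lra. }
  eapply ultimately_imp; [|apply ultimately_and; [apply (Hh d Hd) | apply (Hk d Hd)]].
  intros z [H1 H2].
  replace (h z * k z - L * M) with ((h z - L) * (k z - M) + ((h z - L) * M + L * (k z - M))) by ring.
  eapply Rle_lt_trans; [apply Rabs_triang|].
  eapply Rle_lt_trans; [apply Rplus_le_compat_l, Rabs_triang|]. rewrite !Rabs_mult.
  pose proof (Rabs_pos L). pose proof (Rabs_pos M).
  pose proof (Rabs_pos (h z - L)). pose proof (Rabs_pos (k z - M)).
  assert (Rabs (h z - L) * Rabs (k z - M) < d * 1) by (apply Rmult_le_0_lt_compat; lra).
  assert (Rabs (h z - L) * Rabs M <= d * Rabs M) by (apply Rmult_le_compat_r; lra).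
  assert (Rabs L * Rabs (k z - M) <= Rabs L * d) by (apply Rmult_le_compat_l; lra).
  unfold b in Hdb. lra.
Qed.

Lemma tends_minus h k L M : tends h L -> tends k M -> tends (fun z => h z - k z) (L - M).
Proof.
  intros Hh Hk. replace (L - M) with (L + (-1) * M) by ring.
  intros e He. eapply ultimately_imp; [|apply (tends_plus h (fun z => (-1) * k z) L ((-1) * M))]; eauto.
  - intros z Hz. now replace (h z - k z) with (h z + -1 * k z) by ring.
  - apply tends_mult; auto. apply tends_const.
Qed.

Lemma tends_clamp h L : tends h L -> tends (fun z => clamp (h z)) (clamp L).
Proof.
  intros Hh e He. eapply ultimately_imp; [|apply (Hh e He)]. intros z Hz. simpl in *.
  apply Rabs_def2 in Hz. apply Rabs_def1;
  destruct (clamp_cases (h z)) as [H | [H | H]], (clamp_cases L) as [H' | [H' | H']]; lra.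
Qed.

Lemma tends_lt h L c : tends h L -> L < c -> ultimately (fun z => h z < c).
Proof.
  intros Hh Hc. eapply ultimately_imp; [|apply (Hh (c - L)); lra].
  intros z Hz. apply Rabs_def2 in Hz. lra.
Qed.

Lemma tends_gt h L c : tends h L -> c < L -> ultimately (fun z => c < h z).
Proof.
  intros Hh Hc. eapply ultimately_imp; [|apply (Hh (L - c)); lra].
  intros z Hz. apply Rabs_def2 in Hz. lra.
Qed.

Lemma tends_sumR {A} (h : A -> Z -> R) (L : A -> R) (l : list A) :
  (forall x, In x l -> tends (h x) (L x)) ->
  tends (fun z => sumR A (fun x => h x z) l) (sumR A L l).
Proof.
  induction l as [|x l IH]; simpl; intros H; [apply tends_const|].
  apply tends_plus; auto.
Qed.

Lemma tends_ext h k L : (forall d z, B d z -> h z = k z) -> tends h L -> tends k L.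
Proof.
  intros E Hh e He. destruct (Hh e He) as [d [Hd H]]. exists d. split; auto.
  intros z Hz. rewrite <- (E d z Hz). auto.
Qed.

End Limits.

Section FiniteSums.
Variable V : Type.
Notation sumR := (sumR V).

Definition vertex_eq_dec (x y : V) : {x = y} + {x <> y} := excluded_middle_informative (x = y).

Definition delta (x y : V) : R := if vertex_eq_dec x y then 1 else 0.

Lemma delta_same x : delta x x = 1.
Proof. unfold delta. now destruct (vertex_eq_dec x x). Qed.

Lemma delta_diff x y : x <> y -> delta x y = 0.
Proof. unfold delta. now destruct (vertex_eq_dec x y). Qed.

Lemma delta_pos x y : 0 < delta x y -> x = y.
Proof. unfold delta. destruct (vertex_eq_dec x y); auto; lra. Qed.

Lemma delta_bounds x y : 0 <= delta x y <= 1.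
Proof. unfold delta. destruct (vertex_eq_dec x y); lra. Qed.

Lemma sumR_ext p q l : (forall x, In x l -> p x = q x) -> sumR p l = sumR q l.
Proof.
  induction l as [|a l IH]; simpl; intros H; auto. rewrite H, IH; auto.
Qed.

Lemma sumR_plus p q l : sumR (fun x => p x + q x) l = sumR p l + sumR q l.
Proof. induction l as [|a l IH]; simpl; [ring|]. rewrite IH. ring. Qed.

Lemma sumR_scal c p l : sumR (fun x => c * p x) l = c * sumR p l.
Proof. induction l as [|a l IH]; simpl; [ring|]. rewrite IH. ring. Qed.

Lemma sumR_zero p l : (forall x, In x l -> p x = 0) -> sumR p l = 0.
Proof.
  intros H. rewrite (sumR_ext p (fun x => 0 * p x)), sumR_scal; [ring|].
  intros x Hx. rewrite H; auto. ring.
Qed.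

Lemma sumR_single p l x : NoDup l -> In x l ->
  (forall y, In y l -> y <> x -> p y = 0) -> sumR p l = p x.
Proof.
  induction l as [|a l IH]; simpl; [tauto|]. intros Hnd Hx Hz. inversion Hnd; subst.
  destruct (vertex_eq_dec a x) as [-> | Hne].
  - rewrite sumR_zero; [ring|]. intros y Hy. apply Hz; auto. now intros ->.
  - destruct Hx as [Hx | Hx]; [contradiction|]. rewrite IH; auto. rewrite (Hz a); auto. ring.
Qed.

Lemma sumR_support p l l' : NoDup l -> NoDup l' ->
  (forall x, p x <> 0 -> In x l /\ In x l') -> sumR p l = sumR p l'.
Proof.
  intros Hl Hl' Hp.
  set (nz := fun x => if Req_EM_T (p x) 0 then false else true).
  assert (Hf : forall k, sumR p k = sumR p (filter nz k)).
  { induction k as [|a k IH]; simpl; auto. unfold nz at 1.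
    destruct (Req_EM_T (p a) 0) as [E | E]; simpl; rewrite IH; [rewrite E; ring | auto]. }
  assert (Hperm : forall k k', Permutation k k' -> sumR p k = sumR p k').
  { induction 1; simpl; lra. }
  rewrite (Hf l), (Hf l'). apply Hperm, NoDup_Permutation; try now apply NoDup_filter.
  intros x. rewrite !filter_In. unfold nz. destruct (Req_EM_T (p x) 0) as [E | E].
  - split; intros [_ H]; discriminate.
  - specialize (Hp x E). tauto.
Qed.

End FiniteSums.

Section Realization.
Variables (V : Type) (adj : V -> V -> Prop).
Notation near := (near V adj).
Notation sumR := (sumR V).
Notation vertex_eq_dec := (vertex_eq_dec V).
Notation delta := (delta V).
Notation realization := (realization V adj).
Notation simplex := (simplex V adj).
Notation list_clique := (list_clique V adj).

Lemma list_clique_near l : list_clique l <-> forall x y, In x l -> In y l -> near x y.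
Proof.
  split; intros H x y Hx Hy.
  - destruct (vertex_eq_dec x y) as [-> | Hne]; [apply near_refl | right; auto].
  - intros Hne. apply near_adj; auto.
Qed.

(* The vertices listed in [L] may be repeated. *)
Definition mix (L : list (R * V)) (y : V) : R :=
  fold_right (fun cx acc => fst cx * delta (snd cx) y + acc) 0 L.

Lemma mix_app L L' y : mix (L ++ L') y = mix L y + mix L' y.
Proof. unfold mix. induction L as [|a L IH]; simpl; [ring|]. rewrite IH. ring. Qed.

Lemma mix_map (w : V -> R) (h : V -> V) l y :
  mix (map (fun x => (w x, h x)) l) y = sumR (fun x => w x * delta (h x) y) l.
Proof. unfold mix. induction l as [|a l IH]; simpl; congruence. Qed.

Lemma mix_simplex L l : (forall c x, In (c, x) L -> 0 <= c /\ In x l) ->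
  fold_right Rplus 0 (map fst L) = 1 -> list_clique l -> simplex l (mix L).
Proof.
  intros HL Hsum Hl.
  assert (Hsupp : forall y, mix L y <> 0 -> In y l).
  { intros y Hy. apply NNPP. intros Hno. apply Hy. clear Hy Hsum.
    induction L as [|[c x] L IH]; simpl; auto.
    fold (mix L y). rewrite IH; [|intros; apply HL; now right].
    rewrite delta_diff; [ring|]. intros ->. apply Hno. apply (HL c y). now left. }
  split; auto. split.
  - intros y. clear Hsum Hsupp. induction L as [|[c x] L IH]; simpl; [lra|].
    fold (mix L y). pose proof (delta_bounds V x y). destruct (HL c x) as [Hc _]; [now left|].
    assert (0 <= mix L y) by (apply IH; intros; apply HL; now right).
    assert (0 <= c * delta x y) by (apply Rmult_le_pos; lra). lra.
  - exists (nodup vertex_eq_dec l). split; [apply NoDup_nodup|]. split.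
    { intros x y Hx Hy. rewrite nodup_In in Hx, Hy. now apply Hl. }
    split; [intros x Hx; now apply nodup_In, Hsupp|].
    rewrite <- Hsum. clear Hsum Hsupp. induction L as [|[c x] L IH]; simpl.
    + now apply sumR_zero.
    + rewrite <- IH by (intros; apply HL; now right).
      unfold mix at 1. simpl.
      rewrite (sumR_plus V (fun y => c * delta x y)), sumR_scal.
      rewrite (sumR_single V _ _ x); [rewrite delta_same; unfold mix; ring | apply NoDup_nodup | |].
      * apply nodup_In, (HL c x). now left.
      * intros y _ Hne. apply delta_diff. auto.
Qed.

Lemma realization_delta x : realization (delta x).
Proof.
  assert (H : simplex (x :: nil) (mix ((1, x) :: nil))).
  { apply mix_simplex; simpl.
    - intros c y [E | []]. injection E as <- <-. split; [lra | auto].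
    - ring.
    - intros a b [<- | []] [<- | []] Hne. now destruct Hne. }
  replace (delta x) with (mix ((1, x) :: nil)); [apply H|].
  extensionality y. unfold mix. simpl. ring.
Qed.

Lemma support_near p x y : realization p -> 0 < p x -> 0 < p y -> near x y.
Proof.
  intros [_ [l [_ [Hl [Hs _]]]]] Hx Hy.
  apply (proj1 (list_clique_near l) Hl); apply Hs; lra.
Qed.

Lemma realization_pos p : realization p -> exists x, 0 < p x.
Proof.
  intros [Hp [l [_ [_ [_ Hsum]]]]]. apply NNPP. intros Hno.
  rewrite sumR_zero in Hsum; [lra|]. intros x _. destruct (Hp x) as [H | H]; auto.
  destruct Hno. eauto.
Qed.

Lemma open_star x : wopen V adj (fun p => realization p /\ 0 < p x).
Proof.
  split; [now intros p [H _]|]. intros l Hl p [Hp Hx] [_ Hs]. exists (p x). split; auto.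
  intros q [Hq _] Hnear. split; auto.
  assert (Hin : In x l) by (apply Hs; lra). specialize (Hnear x Hin).
  apply Rabs_def2 in Hnear. lra.
Qed.

(** A weakly open set is controlled on one closed simplex at a time, without uniformity. If the
    nearby values lie in finitely many simplices that also contain the limit, the finitely many
    radii have a positive minimum and convergence of coordinates suffices. *)
Lemma simplexwise_continuous (Z : Type) (B : R -> Z -> Prop)
  (B_mono : forall d e z, d <= e -> B d z -> B e z) (h : Z -> V -> R) (p : V -> R)
  (Ls : list (list V)) (U : (V -> R) -> Prop) :
  (forall l, In l Ls -> list_clique l) ->
  ultimately Z B (fun z => exists l, In l Ls /\ simplex l (h z) /\ simplex l p) ->
  (forall v, tends Z B (fun z => h z v) (p v)) ->
  wopen V adj U -> U p -> ultimately Z B (fun z => U (h z)).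
Proof.
  intros HLs Hev Hlim [_ HU] Up.
  assert (Hl : ultimately Z B (fun z => forall l, In l Ls -> simplex l p -> simplex l (h z) -> U (h z))).
  { apply ultimately_list; auto. intros l Hin.
    destruct (classic (simplex l p)) as [Hp | Hp].
    2:{ exists 1. split; [lra|]. intros z _ Hp'. contradiction. }
    destruct (HU l (HLs l Hin) p Up Hp) as [e [He Hq]].
    eapply ultimately_imp; [|apply (ultimately_list _ _ B_mono
      (fun x z => Rabs (h z x - p x) < e) l)].
    - intros z Hz _ Hsz. apply Hq; auto. intros x Hx. rewrite Rabs_minus_sym. now apply Hz.
    - intros x _. now apply Hlim. }
  eapply ultimately_imp; [|apply (ultimately_and _ _ B_mono _ _ Hev Hl)].
  intros z [[l [Hin [Hz Hp]]] Hall]. eauto.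
Qed.

(* Weights [c j] of the successive edges of a walk; at most one of them lies strictly
   between 0 and 1, the earlier ones being 1 and the later ones 0. *)
Definition staged (c : nat -> R) : Prop :=
  forall j, 0 <= c j <= 1 /\ (c j < 1 -> c (S j) = 0).

(** The point reached on the walk [x], in telescoped form: as a polynomial in the weights it is
    visibly continuous, while [trail_stage] locates it on a single edge. *)
Fixpoint trail (x : nat -> V) (c : nat -> R) (k : nat) (v : V) : R :=
  match k with
  | O => delta (x O) v
  | S k => trail x c k v + c k * (delta (x (S k)) v - delta (x k) v)
  end.

Lemma stage_exists c K : staged c ->
  exists i, (i <= K)%nat /\ (forall j, (j < i)%nat -> c j = 1) /\
    (forall j, (i < j < K)%nat -> c j = 0) /\ ((i < K)%nat -> c i < 1).
Proof.
  intros Hc. induction K as [|K [i [Hi [H1 [H0 Hlt]]]]].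
  - exists O. split; auto. repeat split; intros; lia.
  - destruct (Nat.eq_dec i K) as [-> | Hne].
    + destruct (Rlt_le_dec (c K) 1) as [HcK | HcK].
      * exists K. split; [lia|]. split; auto. split; auto. intros j Hj. lia.
      * exists (S K). split; [lia|]. split; [|split; intros; lia]. intros j Hj.
        destruct (Nat.eq_dec j K) as [-> | Hj']; [pose proof (Hc K); lra | apply H1; lia].
    + exists i. split; [lia|]. split; auto. split; [|intros; apply Hlt; lia]. intros j Hj.
      destruct (Nat.eq_dec j K) as [-> | Hj']; [|apply H0; lia].
      destruct (Nat.eq_dec (S i) K) as [<- | HK]; [apply Hc, Hlt; lia|].
      destruct K as [|K]; [lia|]. apply Hc. rewrite H0 by lia. lra.
Qed.

Lemma trail_done x c k v : (forall j, (j < k)%nat -> c j = 1) -> trail x c k v = delta (x k) v.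
Proof.
  induction k as [|k IH]; simpl; auto. intros H. rewrite IH, H; auto. ring.
Qed.

Lemma trail_stage x c k K i v : (i <= K)%nat -> (k <= K)%nat ->
  (forall j, (k <= j)%nat -> x j = x k) ->
  (forall j, (j < i)%nat -> c j = 1) -> (forall j, (i < j < K)%nat -> c j = 0) ->
  trail x c k v = (1 - c i) * delta (x i) v + c i * delta (x (S i)) v.
Proof.
  intros Hi Hk Hx H1 H0.
  destruct (Nat.le_gt_cases k i) as [Hki | Hki].
  - rewrite trail_done by (intros; apply H1; lia). rewrite (Hx i), (Hx (S i)) by lia. ring.
  - assert (Hn : forall n, (n + S i <= K)%nat -> trail x c (n + S i) v = trail x c (S i) v).
    { induction n as [|n IH]; intros Hn; auto.
      change (S n + S i)%nat with (S (n + S i)). simpl trail at 1.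
      rewrite H0 by lia. rewrite IH by lia. ring. }
    replace k with ((k - S i) + S i)%nat by lia. rewrite Hn by lia.
    simpl. rewrite trail_done by auto. ring.
Qed.

Lemma tends_trail (Z : Type) (B : R -> Z -> Prop)
  (B_mono : forall d e z, d <= e -> B d z -> B e z) x (c : nat -> Z -> R) (c0 : nat -> R) k v :
  (forall j, tends Z B (c j) (c0 j)) ->
  tends Z B (fun z => trail x (fun j => c j z) k v) (trail x c0 k v).
Proof.
  intros Hc. induction k as [|k IH]; simpl; [apply tends_const|].
  apply tends_plus; auto. apply tends_mult; auto. apply tends_const.
Qed.

(* A stage of a nearby weight vector is also a stage of the limit. *)
Lemma stage_persists (Z : Type) (B : R -> Z -> Prop)
  (B_mono : forall d e z, d <= e -> B d z -> B e z) (c : nat -> Z -> R) (c0 : nat -> R) K :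
  (forall j, tends Z B (c j) (c0 j)) -> staged c0 ->
  ultimately Z B (fun z => forall j, (j < K)%nat ->
    (c j z = 1 -> c0 j = 1) /\ (c j z = 0 -> c0 j = 0)).
Proof.
  intros Hc Hs.
  eapply ultimately_imp; [|apply (ultimately_list Z B B_mono
    (fun j z => (c j z = 1 -> c0 j = 1) /\ (c j z = 0 -> c0 j = 0)) (seq 0 K))].
  - intros z H j Hj. apply H, in_seq. lia.
  - intros j _. apply ultimately_and; auto.
    + destruct (Req_dec (c0 j) 1) as [E | E].
      * exists 1. split; [lra|]. auto.
      * eapply ultimately_imp; [|apply (tends_lt Z B _ _ 1 (Hc j))].
        -- intros z Hz E'. simpl in Hz. lra.
        -- pose proof (Hs j). lra.
    + destruct (Req_dec (c0 j) 0) as [E | E].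
      * exists 1. split; [lra|]. auto.
      * eapply ultimately_imp; [|apply (tends_gt Z B _ _ 0 (Hc j))].
        -- intros z Hz E'. simpl in Hz. lra.
        -- pose proof (Hs j). lra.
Qed.

End Realization.

(** * Contracting the clique complex *)

Section Contraction.
Variables (V : Type) (adj : V -> V -> Prop).
Hypothesis G : is_graph V adj.
Local Hint Resolve near_refl near_sym : core.
Notation near := (near V adj).
Notation sumR := (sumR V).
Notation realization := (realization V adj).
Notation simplex := (simplex V adj).
Notation list_clique := (list_clique V adj).
Notation wopen := (wopen V adj).
Notation delta := (delta V).
Notation trail := (trail V).
Notation mix := (mix V).

(* The parameters are confined to a compact interval [J] around [t]; by the tube lemma the
   points whose whole track over [J] stays in [U] form a weakly open set. *)
Lemma homotopy_of_simplexwise (H : R -> (V -> R) -> V -> R) :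
  (forall t p, unit_interval t -> realization p -> realization (H t p)) ->
  (forall l U t p, list_clique l -> wopen U -> unit_interval t -> simplex l p -> U (H t p) ->
     exists e, 0 < e /\ forall s q, unit_interval s -> simplex l q -> Rabs (s - t) < e ->
       (forall x, In x l -> Rabs (p x - q x) < e) -> U (H s q)) ->
  homotopy_cont V adj H.
Proof.
  intros Hr Hc. split; auto. intros U HU t p Ht Hp Up.
  assert (Hpl : exists l, list_clique l /\ simplex l p).
  { destruct Hp as [Hp [l [H1 [H2 [H3 H4]]]]]. exists l. split; auto. split; auto.
    split; auto. exists l. auto. }
  destruct Hpl as [l [Hl Hpl]].
  destruct (Hc l U t p Hl HU Ht Hpl Up) as [e [He HJ]].
  set (lo := Rmax 0 (t - e / 2)). set (hi := Rmin 1 (t + e / 2)).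
  assert (Hlh : 0 <= lo /\ lo <= t /\ t <= hi /\ hi <= 1 /\ t - e / 2 <= lo /\ hi <= t + e / 2).
  { unfold lo, hi, unit_interval in *. unfold Rmax, Rmin.
    destruct (Rle_dec 0 (t - e / 2)), (Rle_dec 1 (t + e / 2)); lra. }
  exists (e / 2), (fun q => realization q /\ forall s, lo <= s <= hi -> U (H s q)).
  split; [lra|]. split; [|split].
  - split; [now intros q [Hq _]|]. intros k Hk q [Hq HUq] Hqk.
    assert (Htube : exists d, 0 < d /\ forall s q', lo <= s <= hi -> simplex k q' ->
              (forall x, In x k -> Rabs (q x - q' x) < d) -> U (H s q')).
    { apply (interval_induction lo hi (fun a b => exists d, 0 < d /\
        forall s q', a <= s <= b -> simplex k q' ->
              (forall x, In x k -> Rabs (q x - q' x) < d) -> U (H s q'))); [lra| |].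
      - intros a b c Habc [d [Hd H1]] [d' [Hd' H2]]. exists (Rmin d d').
        split; [now apply Rmin_glb_lt|]. intros s q' Hs Hq' Hnear.
        destruct (Rle_lt_dec s b).
        + apply H1; auto; [lra|]. intros x Hx.
          eapply Rlt_le_trans; [now apply Hnear | apply Rmin_l].
        + apply H2; auto; [lra|]. intros x Hx.
          eapply Rlt_le_trans; [now apply Hnear | apply Rmin_r].
      - intros s Hs. destruct (Hc k U s q Hk HU) as [d [Hd Hd']]; auto.
        { unfold unit_interval. lra. }
        exists d. split; auto. intros a b Ha Hb Ha' Hb'. exists d. split; auto.
        intros s' q' Hs' Hq' Hnear. apply Hd'; auto.
        + unfold unit_interval. lra.
        + apply Rabs_def1; lra. }
    destruct Htube as [d [Hd Htube]]. exists d. split; auto. intros q' Hq' Hnear.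
    split; [apply Hq'|]. intros s Hs. apply Htube; auto.
  - split; auto. intros s Hs. apply HJ; auto.
    + unfold unit_interval. lra.
    + apply Rabs_def1; lra.
    + intros x _. rewrite Rminus_diag, Rabs_R0. auto.
  - intros s q Hs Hst [_ Hq]. apply Hq. apply Rabs_def2 in Hst.
    unfold lo, hi, unit_interval in *. unfold Rmax, Rmin.
    destruct (Rle_dec 0 (t - e / 2)), (Rle_dec 1 (t + e / 2)); lra.
Qed.

Variable u : V.
Hypothesis HD : ball_dominated V adj G.
Notation dist := (gdist V adj G).

Lemma lower_exists v : exists x, v <> u -> dominates_toward V adj G u v x.
Proof.
  destruct (classic (u = v)) as [-> | Hne]; [now exists v|].
  destruct (HD u v Hne) as [x Hx]. eauto.
Qed.

Definition lower (v : V) : V :=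
  proj1_sig (constructive_indefinite_description _ (lower_exists v)).

Lemma lower_spec v k : dist u v = S k -> dist u (lower v) = k /\
  forall w, near v w -> (dist u w <= S k)%nat -> near (lower v) w.
Proof.
  intros E. unfold lower. destruct constructive_indefinite_description as [x Hx]. simpl.
  destruct Hx as [H1 H2]; [intros ->; rewrite gdist_refl in E; discriminate|].
  rewrite E in *. split; auto.
  assert (Hxv : near x v) by (apply H2; auto; lia).
  pose proof (near_dist_le V adj G u x v Hxv). lia.
Qed.

(* Truncated subtraction makes this [x] itself when [x] is at distance at most [i] from [u]. *)
Definition ancestor (i : nat) (x : V) : V := Nat.iter (dist u x - i) lower x.

Lemma ancestor_far i x : (dist u x <= i)%nat -> ancestor i x = x.
Proof. intros H. unfold ancestor. now replace (dist u x - i)%nat with O by lia. Qed.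

Lemma ancestor_step i x : (i < dist u x)%nat -> ancestor i x = lower (ancestor (S i) x).
Proof.
  intros H. unfold ancestor. now replace (dist u x - i)%nat with (S (dist u x - S i)) by lia.
Qed.

Lemma ancestor_dist i x : dist u (ancestor i x) = Nat.min i (dist u x).
Proof.
  assert (Hm : forall m, (m <= dist u x)%nat -> dist u (Nat.iter m lower x) = (dist u x - m)%nat).
  { induction m as [|m IH]; intros Hm; [simpl; lia|].
    simpl. destruct (lower_spec (Nat.iter m lower x) (dist u x - S m)) as [H _]; auto.
    rewrite IH; lia. }
  unfold ancestor. rewrite Hm; lia.
Qed.

Lemma ancestor_0 x : ancestor 0 x = u.
Proof.
  symmetry. apply (gdist_0 V adj G). rewrite ancestor_dist. lia.
Qed.

(** Downward induction on [i], starting where both ancestors are the vertices themselves. The two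
    vertices are lowered one after the other, each domination using the current position of the
    other; the intermediate position is the second conclusion, and it makes two consecutive levels
    of a clique span a clique. *)
Lemma ancestor_near i x y : near x y ->
  near (ancestor i x) (ancestor i y) /\ near (ancestor i x) (ancestor (S i) y).
Proof.
  intros Hxy.
  assert (Hn : forall n i, (dist u x <= i + n)%nat -> (dist u y <= i + n)%nat ->
    near (ancestor i x) (ancestor i y) /\ near (ancestor i x) (ancestor (S i) y)).
  2:{ apply (Hn (dist u x + dist u y)%nat); lia. }
  clear i. induction n as [|n IH]; intros i Hx Hy.
  { rewrite !ancestor_far by lia. auto. }
  destruct (IH (S i)) as [Hab _]; try lia.
  set (a := ancestor (S i) x) in *. set (b := ancestor (S i) y) in *.
  assert (Ha : (dist u a <= S i)%nat) by (unfold a; rewrite ancestor_dist; lia).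
  assert (Hb : (dist u b <= S i)%nat) by (unfold b; rewrite ancestor_dist; lia).
  assert (Hdown : forall z w, (dist u (ancestor (S i) z) <= S i)%nat ->
            near (ancestor (S i) z) w -> (dist u w <= S i)%nat -> near (ancestor i z) w).
  { intros z w Hz Hzw Hw. destruct (Nat.le_gt_cases (dist u z) i) as [Hle | Hgt].
    - rewrite ancestor_far in Hzw |- * by lia. auto.
    - rewrite ancestor_step by auto.
      apply (lower_spec (ancestor (S i) z) i); auto. rewrite ancestor_dist. lia. }
  assert (Hxb : near (ancestor i x) b) by (apply Hdown; auto).
  split; auto. apply near_sym; auto. apply Hdown; auto. rewrite ancestor_dist. lia.
Qed.

(** Trails run from [u] outwards, so weight 1 means that the point is still beyond level [j]. The
    value is 1 up to [t = 2^-(j+1)] and 0 from [t = 2^-j] on, so infinitely many levels are crossed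
    one at a time. *)
Definition weight (t : R) (j : nat) : R := clamp ((/ 2 ^ j - t) * 2 ^ S j).

Lemma weight_staged t : staged (weight t).
Proof.
  intros j. split; [apply clamp_bounds|]. intros H.
  assert (Hp : 0 < 2 ^ j) by (apply pow_lt; lra).
  assert (E : / 2 ^ S j = / 2 ^ j / 2) by (simpl; field; lra).
  assert (Ht : / 2 ^ S j < t).
  { apply Rnot_le_lt. intros Hle.
    assert (1 <= (/ 2 ^ j - t) * 2 ^ S j).
    { assert (Hq : (/ 2 ^ j - / 2 ^ S j) * 2 ^ S j = 1) by (simpl; field; lra).
      rewrite <- Hq at 1. apply Rmult_le_compat_r; [simpl; lra | lra]. }
    unfold weight in H. destruct (clamp_cases ((/ 2 ^ j - t) * 2 ^ S j)) as [C | [C | C]]; lra. }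
  unfold weight. assert (Hn : (/ 2 ^ S j - t) * 2 ^ S (S j) <= 0).
  { assert (0 < 2 ^ S (S j)) by (apply pow_lt; lra).
    replace 0 with (0 * 2 ^ S (S j)) by ring. apply Rmult_le_compat_r; lra. }
  destruct (clamp_cases ((/ 2 ^ S j - t) * 2 ^ S (S j))) as [C | [C | C]]; lra.
Qed.

Lemma weight_0 j : weight 0 j = 1.
Proof.
  unfold weight. assert (Hp : 0 < 2 ^ j) by (apply pow_lt; lra).
  replace ((/ 2 ^ j - 0) * 2 ^ S j) with 2 by (simpl; field; lra).
  destruct (clamp_cases 2) as [C | [C | C]]; lra.
Qed.

Lemma weight_1 j : weight 1 j = 0.
Proof.
  unfold weight. assert (Hp : 1 <= 2 ^ j) by (apply pow_R1_Rle; lra).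
  assert (Hi : / 2 ^ j <= 1) by (rewrite <- Rinv_1; apply Rinv_le_contravar; lra).
  assert (Hn : (/ 2 ^ j - 1) * 2 ^ S j <= 0).
  { replace 0 with (0 * 2 ^ S j) by ring. apply Rmult_le_compat_r; [simpl; lra | lra]. }
  destruct (clamp_cases ((/ 2 ^ j - 1) * 2 ^ S j)) as [C | [C | C]]; lra.
Qed.

Definition carrier (p : V -> R) : list V :=
  epsilon (inhabits nil) (fun l => NoDup l /\ list_clique l /\
    (forall x, p x <> 0 -> In x l) /\ sumR p l = 1).

Lemma carrier_spec p : realization p -> NoDup (carrier p) /\ list_clique (carrier p) /\
  (forall x, p x <> 0 -> In x (carrier p)) /\ sumR p (carrier p) = 1.
Proof. intros [_ Hp]. unfold carrier. now apply epsilon_spec. Qed.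

(* As [t] increases from 0 to 1, each vertex travels along its ancestors towards [u]. *)
Definition contraction (t : R) (p : V -> R) (v : V) : R :=
  sumR (fun x => p x * trail (fun j => ancestor j x) (weight t) (dist u x) v) (carrier p).

(** Independence of the chosen [carrier]: one list can serve all points of a simplex, as continuity
    requires. *)
Lemma contraction_on l t p v : NoDup l -> simplex l p -> contraction t p v =
  sumR (fun x => p x * trail (fun j => ancestor j x) (weight t) (dist u x) v) l.
Proof.
  intros Hl [Hp Hs]. destruct (carrier_spec p Hp) as [Hnd [_ [Hc _]]].
  apply sumR_support; auto. intros x Hx.
  assert (p x <> 0) by (intros E; apply Hx; rewrite E; ring). auto.
Qed.

Definition stage_list (l : list V) (i : nat) : list V :=
  map (ancestor i) l ++ map (ancestor (S i)) l.

Lemma stage_list_clique l i : list_clique l -> list_clique (stage_list l i).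
Proof.
  rewrite !(list_clique_near V adj). intros Hl a b Ha Hb.
  unfold stage_list in Ha, Hb. rewrite in_app_iff, !in_map_iff in Ha, Hb.
  destruct Ha as [[x [<- Hx]] | [x [<- Hx]]], Hb as [[y [<- Hy]] | [y [<- Hy]]].
  - apply ancestor_near; auto.
  - apply ancestor_near; auto.
  - apply near_sym; auto. apply ancestor_near; auto.
  - apply ancestor_near; auto.
Qed.

Lemma contraction_stage l t p K i : NoDup l -> list_clique l -> simplex l p ->
  (forall x, In x l -> (dist u x <= K)%nat) -> (i <= K)%nat ->
  (forall j, (j < i)%nat -> weight t j = 1) ->
  (forall j, (i < j < K)%nat -> weight t j = 0) ->
  simplex (stage_list l i) (contraction t p).
Proof.
  intros Hnd Hl Hs HK Hi H1 H0.
  set (c := weight t i). assert (Hc : 0 <= c <= 1) by apply weight_staged.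
  set (L := map (fun x => (p x * (1 - c), ancestor i x)) l ++
            map (fun x => (p x * c, ancestor (S i) x)) l).
  assert (E : contraction t p = mix L).
  { extensionality v. rewrite (contraction_on l) by auto. unfold L.
    rewrite mix_app, !mix_map, <- sumR_plus. apply sumR_ext. intros x Hx.
    rewrite (trail_stage V _ _ _ K i); auto; [fold c; ring|].
    intros j Hj. rewrite !ancestor_far; auto. }
  rewrite E. destruct Hs as [Hp Hs]. pose proof (proj1 Hp) as Hpos.
  apply mix_simplex; [ | | now apply stage_list_clique].
  - intros d y Hin. unfold L, stage_list in *. rewrite in_app_iff, !in_map_iff in *.
    destruct Hin as [[x [E' Hx]] | [x [E' Hx]]]; injection E' as <- <-.
    + split; [apply Rmult_le_pos; auto; lra|]. left. eauto.
    + split; [apply Rmult_le_pos; auto; lra|]. right. eauto.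
  - destruct (carrier_spec p Hp) as [Hnd' [_ [Hc' Hsum]]].
    rewrite <- Hsum, (sumR_support V p (carrier p) l); auto.
    unfold L. clear. rewrite map_app, !map_map. simpl.
    assert (Hf : forall a b : list R, fold_right Rplus 0 (a ++ b) =
              fold_right Rplus 0 a + fold_right Rplus 0 b).
    { induction a; intros; simpl; [ring | rewrite IHa; ring]. }
    rewrite Hf. induction l as [|x l IH]; simpl; [ring|]. lra.
Qed.

Lemma far_bound (l : list V) : exists K, forall x, In x l -> (dist u x <= K)%nat.
Proof.
  induction l as [|a l [K HK]]; [exists O; intros x []|].
  exists (Nat.max (dist u a) K). intros x [<- | Hx]; [lia|]. specialize (HK x Hx). lia.
Qed.

(** Distances to [u] are bounded by some [K] on a simplex, so the images lie in the [K + 1]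
    simplices spanned by consecutive ancestor levels. By [stage_persists], the one containing a
    nearby image also contains the limit. *)
Lemma contraction_simplexwise l U t p : list_clique l -> wopen U -> unit_interval t ->
  simplex l p -> U (contraction t p) ->
  exists e, 0 < e /\ forall s q, unit_interval s -> simplex l q -> Rabs (s - t) < e ->
    (forall x, In x l -> Rabs (p x - q x) < e) -> U (contraction s q).
Proof.
  intros Hl HU Ht Hp Up.
  set (k := nodup (vertex_eq_dec V) l).
  assert (Hk : forall x, In x k <-> In x l) by (intros x; apply nodup_In).
  assert (Hkl : list_clique k) by (intros x y Hx Hy; apply Hl; now apply Hk).
  assert (Hks : forall q, simplex l q -> simplex k q).
  { intros q [Hq Hs]. split; auto. intros x Hx. apply Hk; auto. }
  assert (Hknd : NoDup k) by apply NoDup_nodup.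
  destruct (far_bound k) as [K HK].
  set (B := fun d (z : R * (V -> R)) => simplex l (snd z) /\ Rabs (fst z - t) < d /\
              forall x, In x l -> Rabs (p x - snd z x) < d).
  assert (B_mono : forall d e z, d <= e -> B d z -> B e z).
  { intros d e z Hde [H1 [H2 H3]]. split; auto. split; [lra|].
    intros x Hx. specialize (H3 x Hx). lra. }
  assert (Hfst : tends _ B fst t).
  { intros e He. exists e. split; auto. now intros z [_ [H _]]. }
  assert (Hw : forall j, tends _ B (fun z => weight (fst z) j) (weight t j)).
  { intros j. unfold weight. apply tends_clamp. apply tends_mult; auto.
    - apply tends_minus; auto. apply tends_const.
    - apply tends_const. }
  destruct (simplexwise_continuous V adj _ B B_mono
    (fun z => contraction (fst z) (snd z)) (contraction t p)
    (map (stage_list k) (seq 0 (S K))) U) as [e [He HeU]]; auto.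
  - intros m Hm. apply in_map_iff in Hm as [i [<- _]]. now apply stage_list_clique.
  - eapply ultimately_imp; [|apply (ultimately_and _ _ B_mono (fun z => simplex l (snd z)));
      [|apply (stage_persists _ B B_mono (fun j z => weight (fst z) j) _ K Hw (weight_staged t))]].
    + intros z [Hz Hst].
      destruct (stage_exists (weight (fst z)) K (weight_staged _)) as [i [Hi [H1 [H0 _]]]].
      exists (stage_list k i). split; [apply in_map, in_seq; lia|].
      split; apply (contraction_stage k _ _ K i); auto.
      * intros j Hj. apply Hst; [lia | auto].
      * intros j Hj. apply Hst; [lia | auto].
    + exists 1. split; [lra|]. now intros z [Hz _].
  - intros v.
    apply (tends_ext _ B (fun z => sumR (fun x => snd z x *
      trail (fun j => ancestor j x) (weight (fst z)) (dist u x) v) k)).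
    { intros d z [Hz _]. symmetry. apply contraction_on; auto. }
    rewrite (contraction_on k) by auto.
    apply (tends_sumR _ B B_mono (fun x z => snd z x *
      trail (fun j => ancestor j x) (weight (fst z)) (dist u x) v)).
    intros x Hx. apply tends_mult; auto.
    + intros e He. exists e. split; auto. intros z [_ [_ Hz]]. rewrite Rabs_minus_sym.
      apply Hz, Hk, Hx.
    + apply (tends_trail V _ B B_mono _ (fun j z => weight (fst z) j)). auto.
  - exists e. split; auto. intros s q Hs Hq Hst Hpq. apply (HeU (s, q)).
    split; [exact Hq|]. auto.
Qed.

Lemma contraction_realization t p : realization p -> realization (contraction t p).
Proof.
  intros Hp. destruct (carrier_spec p Hp) as [Hnd [Hl [Hs _]]].
  destruct (far_bound (carrier p)) as [K HK].
  destruct (stage_exists (weight t) K (weight_staged _)) as [i [Hi [H1 [H0 _]]]].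
  apply (contraction_stage (carrier p) t p K i); auto. split; auto.
Qed.

Lemma contractible_of_ball_dominated : contractible_X V adj.
Proof.
  exists contraction, (delta u). split; [now apply realization_delta|].
  split; [|split].
  - apply homotopy_of_simplexwise.
    + intros t p _. apply contraction_realization.
    + apply contraction_simplexwise.
  - intros p Hp. extensionality v. unfold contraction.
    destruct (carrier_spec p Hp) as [Hnd [_ [Hc _]]].
    rewrite (sumR_ext V _ (fun x => p x * delta x v)).
    2:{ intros x _. rewrite trail_done by (intros; apply weight_0). now rewrite ancestor_far. }
    destruct (classic (In v (carrier p))) as [Hv | Hv].
    + rewrite (sumR_single V _ _ v); auto.
      * rewrite delta_same. ring.
      * intros y _ Hne. rewrite delta_diff by auto. ring.
    + rewrite sumR_zero.
      * apply NNPP. intros Hne. apply Hv, Hc. auto.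
      * intros x Hx. rewrite delta_diff; [ring|]. now intros ->.
  - intros p Hp. extensionality v. unfold contraction.
    destruct (carrier_spec p Hp) as [Hnd [_ [Hc Hsum]]].
    rewrite (sumR_ext V _ (fun x => delta u v * p x)).
    2:{ intros x _. rewrite (trail_stage V _ _ _ (dist u x) 0); try lia.
        - rewrite !weight_1, ancestor_0. ring.
        - intros j Hj. rewrite !ancestor_far; auto.
        - intros j Hj. apply weight_1. }
    rewrite sumR_scal, Hsum. ring.
Qed.

End Contraction.

(** * Contractible complexes are simply connected *)

Lemma clamp_low r : r <= 0 -> clamp r = 0.
Proof. intros H. destruct (clamp_cases r) as [C | [C | C]]; lra. Qed.

Lemma clamp_mid r : 0 <= r <= 1 -> clamp r = r.
Proof. intros H. destruct (clamp_cases r) as [C | [C | C]]; lra. Qed.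

Lemma clamp_high r : 1 <= r -> clamp r = 1.
Proof. intros H. destruct (clamp_cases r) as [C | [C | C]]; lra. Qed.

Lemma unit_mult a b : unit_interval a -> unit_interval b -> unit_interval (a * b).
Proof.
  intros [Ha Ha'] [Hb Hb']. split; [now apply Rmult_le_pos|].
  replace 1 with (1 * 1) by ring. apply Rmult_le_compat; auto.
Qed.

Lemma unit_convex c a b : unit_interval c -> unit_interval a -> unit_interval b ->
  unit_interval ((1 - c) * a + c * b).
Proof.
  intros [Hc Hc'] [Ha Ha'] [Hb Hb'].
  assert (0 <= (1 - c) * a) by (apply Rmult_le_pos; lra).
  assert (0 <= c * b) by (apply Rmult_le_pos; lra).
  assert ((1 - c) * a <= (1 - c) * 1) by (apply Rmult_le_compat_l; lra).
  assert (c * b <= c * 1) by (apply Rmult_le_compat_l; lra).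
  split; lra.
Qed.

Section Squares.
Variables (V : Type) (adj : V -> V -> Prop).
Notation realization := (realization V adj).
Notation wopen := (wopen V adj).

Definition square_ball (s t d : R) (z : R * R) : Prop :=
  unit_interval (fst z) /\ unit_interval (snd z) /\
  Rabs (fst z - s) < d /\ Rabs (snd z - t) < d.

Lemma square_ball_mono s t d e z : d <= e -> square_ball s t d z -> square_ball s t e z.
Proof. intros H (H1 & H2 & H3 & H4). repeat split; try apply H1; try apply H2; lra. Qed.

Notation near_square s t := (ultimately (R * R)%type (square_ball s t)).

Definition cont2 (a : R -> R -> R) : Prop :=
  forall s t, tends (R * R) (square_ball s t) (fun z => a (fst z) (snd z)) (a s t).

Lemma cont2_const c : cont2 (fun _ _ => c).
Proof. intros s t. apply tends_const. Qed.

Lemma cont2_fst : cont2 (fun s _ => s).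
Proof. intros s t e He. exists e. split; auto. now intros z (_ & _ & H & _). Qed.

Lemma cont2_snd : cont2 (fun _ t => t).
Proof. intros s t e He. exists e. split; auto. now intros z (_ & _ & _ & H). Qed.

Lemma cont2_plus a b : cont2 a -> cont2 b -> cont2 (fun s t => a s t + b s t).
Proof. intros Ha Hb s t. apply tends_plus; auto. exact (square_ball_mono s t). Qed.

Lemma cont2_minus a b : cont2 a -> cont2 b -> cont2 (fun s t => a s t - b s t).
Proof. intros Ha Hb s t. apply tends_minus; auto. exact (square_ball_mono s t). Qed.

Lemma cont2_mult a b : cont2 a -> cont2 b -> cont2 (fun s t => a s t * b s t).
Proof. intros Ha Hb s t. apply tends_mult; auto. exact (square_ball_mono s t). Qed.

Lemma cont2_clamp a : cont2 a -> cont2 (fun s t => clamp (a s t)).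
Proof. intros Ha s t. now apply tends_clamp. Qed.

Lemma square_cont_iff K : square_cont V adj K <->
  (forall s t, unit_interval s -> unit_interval t -> realization (K s t)) /\
  forall U, wopen U -> forall s t, unit_interval s -> unit_interval t -> U (K s t) ->
    near_square s t (fun z => U (K (fst z) (snd z))).
Proof.
  split; intros [Hr Hc]; split; auto; intros U HU s t Hs Ht Us.
  - destruct (Hc U HU s t Hs Ht Us) as [e [He H]]. exists e. split; auto.
    intros z (H1 & H2 & H3 & H4). auto.
  - destruct (Hc U HU s t Hs Ht Us) as [e [He H]]. exists e. split; auto.
    intros s' t' Hs' Ht' H1 H2. apply (H (s', t')). repeat split; auto; apply Hs' || apply Ht'.
Qed.

Lemma square_cont_comp H g a b : homotopy_cont V adj H -> path_cont V adj g ->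
  cont2 a -> cont2 b ->
  (forall s t, unit_interval s -> unit_interval t -> unit_interval (a s t)) ->
  (forall s t, unit_interval s -> unit_interval t -> unit_interval (b s t)) ->
  square_cont V adj (fun s t => H (a s t) (g (b s t))).
Proof.
  intros [Hr Hc] [Hgr Hgc] Ha Hb Hau Hbu. apply square_cont_iff. split; auto.
  intros U HU s t Hs Ht Us.
  destruct (Hc U HU (a s t) (g (b s t))) as (e & W & He & HW & Wg & HWU); auto.
  destruct (Hgc W HW (b s t)) as (d & Hd & HdW); auto.
  eapply ultimately_imp; [|apply (ultimately_and _ _ (square_ball_mono s t)
    (fun z => unit_interval (fst z) /\ unit_interval (snd z)));
    [|apply (ultimately_and _ _ (square_ball_mono s t) _ _ (Ha s t e He) (Hb s t d Hd))]].
  - intros z [Hz [H1 H2]]. apply HWU; [| exact H1 |].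
    + apply Hau; apply Hz.
    + apply HdW; [apply Hbu; apply Hz | exact H2].
  - exists 1. split; [lra|]. intros z (H1 & H2 & _). exact (conj H1 H2).
Qed.

Lemma square_cont_glue K1 K2 a : square_cont V adj K1 -> square_cont V adj K2 -> cont2 a ->
  (forall s t, unit_interval s -> unit_interval t -> a s t = 0 -> K1 s t = K2 s t) ->
  square_cont V adj (fun s t => if Rle_dec (a s t) 0 then K1 s t else K2 s t).
Proof.
  intros HK1 HK2 Ha Heq. apply square_cont_iff in HK1 as [Hr1 Hc1].
  apply square_cont_iff in HK2 as [Hr2 Hc2]. apply square_cont_iff. split.
  { intros s t Hs Ht. destruct (Rle_dec (a s t) 0); auto. }
  intros U HU s t Hs Ht Us.
  destruct (Rtotal_order (a s t) 0) as [Hlt | [E | Hgt]].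
  - eapply ultimately_imp; [|apply (ultimately_and _ _ (square_ball_mono s t) _ _
      (tends_lt _ _ _ _ 0 (Ha s t) Hlt) (Hc1 U HU s t Hs Ht ltac:(destruct (Rle_dec (a s t) 0); [auto | lra])))].
    intros z [H1 H2]. destruct (Rle_dec (a (fst z) (snd z)) 0); [auto | lra].
  - assert (U1 : U (K1 s t)) by (destruct (Rle_dec (a s t) 0); [auto | lra]).
    assert (U2 : U (K2 s t)) by (rewrite <- Heq; auto).
    eapply ultimately_imp; [|apply (ultimately_and _ _ (square_ball_mono s t) _ _
      (Hc1 U HU s t Hs Ht U1) (Hc2 U HU s t Hs Ht U2))].
    intros z [H1 H2]. destruct (Rle_dec (a (fst z) (snd z)) 0); auto.
  - eapply ultimately_imp; [|apply (ultimately_and _ _ (square_ball_mono s t) _ _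
      (tends_gt _ _ _ _ 0 (Ha s t) Hgt) (Hc2 U HU s t Hs Ht ltac:(destruct (Rle_dec (a s t) 0); [lra | auto])))].
    intros z [H1 H2]. destruct (Rle_dec (a (fst z) (snd z)) 0); [lra | auto].
Qed.

Lemma path_cont_const p : realization p -> path_cont V adj (fun _ => p).
Proof.
  intros Hp. split; auto. intros U HU t Ht Up. exists 1. split; [lra | auto].
Qed.

Lemma path_cont_of_square K : square_cont V adj K -> path_cont V adj (fun s => K s 0).
Proof.
  intros [Hr Hc]. assert (H0 : unit_interval 0) by (unfold unit_interval; lra).
  split; [auto|]. intros U HU s Hs Us.
  destruct (Hc U HU s 0 Hs H0 Us) as [e [He H]]. exists e. split; auto.
  intros s' Hs' Hss. apply H; auto. now rewrite Rminus_diag, Rabs_R0.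
Qed.

Local Hint Resolve cont2_const cont2_fst cont2_snd cont2_plus cont2_minus cont2_mult cont2_clamp : cont.

(* The contraction turns a loop [g] at [p] into [c * c^-1], where [c] is the track of [p];
   the latter loop is then retracted along itself. *)
Lemma simply_connected_of_contractible : contractible_X V adj -> simply_connected_X V adj.
Proof.
  intros (H & p0 & Hp0 & HH & H0 & H1).
  assert (Hclamp : forall r, unit_interval (clamp r)) by (intros r; apply clamp_bounds).
  split; [eauto|]. split.
  - intros p q Hp Hq.
    assert (HK : square_cont V adj (fun s _ =>
      if Rle_dec (2 * s - 1) 0 then H (clamp (2 * s)) p else H (clamp (2 - 2 * s)) q)).
    { apply (square_cont_glue (fun s _ => H (clamp (2 * s)) p)
              (fun s _ => H (clamp (2 - 2 * s)) q) (fun s _ => 2 * s - 1)).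
      - apply (square_cont_comp H (fun _ => p) (fun s _ => clamp (2 * s)) (fun _ _ => 0));
          auto using path_cont_const with cont.
        intros; unfold unit_interval; lra.
      - apply (square_cont_comp H (fun _ => q) (fun s _ => clamp (2 - 2 * s)) (fun _ _ => 0));
          auto 6 using path_cont_const with cont.
        intros; unfold unit_interval; lra.
      - auto with cont.
      - intros s t Hs Ht E. rewrite !clamp_high by lra. now rewrite !H1. }
    apply path_cont_of_square in HK.
    eexists. split; [exact HK|]. simpl. split.
    + destruct (Rle_dec (2 * 0 - 1) 0); [|lra]. rewrite clamp_low by lra. auto.
    + destruct (Rle_dec (2 * 1 - 1) 0); [lra|]. rewrite clamp_low by lra. auto.
  - intros g p Hg Hg0 Hg1.
    assert (Hgr : forall s, unit_interval s -> realization (g s)) by apply Hg.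
    assert (Hp : realization p) by (rewrite <- Hg0; apply Hgr; unfold unit_interval; lra).
    (* [m] vanishes at both ends and equals 1 on the middle third, while [b] deforms the identity
       into the path parameter that runs through the loop during the middle third. At [t = 1/2] the
       outer thirds are the track of [p] and its reverse, and the middle third is constant. *)
    set (m := fun s => clamp (3 * s) * clamp (3 - 3 * s)).
    assert (Hm : forall s, unit_interval (m s)) by (intros; apply unit_mult; auto).
    set (b := fun s t => (1 - clamp (2 * t)) * s + clamp (2 * t) * clamp (3 * s - 1)).
    exists (fun s t => if Rle_dec (2 * t - 1) 0
      then H (clamp (2 * t) * m s) (g (b s t)) else H (clamp (2 - 2 * t) * m s) p).
    assert (Hm0 : m 0 = 0) by (unfold m; rewrite (clamp_low (3 * 0)) by lra; ring).
    assert (Hm1 : m 1 = 0) by (unfold m; rewrite (clamp_low (3 - 3 * 1)) by lra; ring).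
    split; [|split; [|split]].
    + apply (square_cont_glue (fun s t => H (clamp (2 * t) * m s) (g (b s t)))
              (fun s t => H (clamp (2 - 2 * t) * m s) p) (fun _ t => 2 * t - 1)).
      * apply (square_cont_comp H g (fun s t => clamp (2 * t) * m s) b); auto.
        -- unfold m. auto 8 with cont.
        -- unfold b. auto 8 with cont.
        -- intros. now apply unit_mult.
        -- intros. now apply unit_convex.
      * apply (square_cont_comp H (fun _ => p) (fun s t => clamp (2 - 2 * t) * m s)
                 (fun _ _ => 0)); auto using path_cont_const.
        -- unfold m. auto 8 with cont.
        -- auto with cont.
        -- intros. now apply unit_mult.
        -- intros. unfold unit_interval. lra.
      * auto with cont.
      * intros s t Hs Ht E. rewrite !(clamp_high (_ * t)), (clamp_high (2 - 2 * t)) by lra.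
        unfold b. rewrite (clamp_high (2 * t)) by lra.
        replace ((1 - 1) * s + 1 * clamp (3 * s - 1)) with (clamp (3 * s - 1)) by ring.
        destruct (Rle_lt_dec s (1 / 3)) as [Hc | Hc].
        { rewrite clamp_low by lra. now rewrite Hg0. }
        destruct (Rle_lt_dec (2 / 3) s) as [Hc' | Hc'].
        { rewrite clamp_high by lra. now rewrite Hg1. }
        unfold m. rewrite (clamp_high (3 * s)), (clamp_high (3 - 3 * s)) by lra.
        replace (1 * (1 * 1)) with 1 by ring. now rewrite !H1; auto.
    + intros s Hs. destruct (Rle_dec (2 * 0 - 1) 0); [|lra]. unfold b.
      rewrite (clamp_low (2 * 0)) by lra. replace (0 * m s) with 0 by ring.
      replace ((1 - 0) * s + 0 * clamp (3 * s - 1)) with s by ring. auto.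
    + intros s Hs. destruct (Rle_dec (2 * 1 - 1) 0); [lra|].
      rewrite (clamp_low (2 - 2 * 1)) by lra. replace (0 * m s) with 0 by ring. auto.
    + intros t Ht. unfold b. rewrite Hm0, Hm1, (clamp_low (3 * 0 - 1)), (clamp_high (3 * 1 - 1)) by lra.
      replace ((1 - clamp (2 * t)) * 0 + clamp (2 * t) * 0) with 0 by ring.
      replace (clamp (2 * t) * 0) with 0 by ring. replace (clamp (2 - 2 * t) * 0) with 0 by ring.
      replace ((1 - clamp (2 * t)) * 1 + clamp (2 * t) * 1) with 1 by ring.
      rewrite Hg0, Hg1, H0 by auto. destruct (Rle_dec (2 * t - 1) 0); auto.
Qed.

End Squares.

(** * Null-homotopies and covers *)

Section Monodromy.
Variables (V : Type) (adj : V -> V -> Prop).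
Hypothesis G : is_graph V adj.
Local Hint Resolve near_refl near_sym : core.
Notation near := (near V adj).
Notation realization := (realization V adj).
Notation simplex := (simplex V adj).
Notation list_clique := (list_clique V adj).
Notation delta := (delta V).

Section WalkPath.
Variables (x : nat -> V) (n : nat).
Hypothesis Hn : (0 < n)%nat.
Hypothesis Hx : forall i, near (x i) (x (S i)).
Hypothesis Hstop : forall j, (n <= j)%nat -> x j = x n.

Definition walk_weight (s : R) (j : nat) : R := clamp (INR n * s - INR j).

Definition walk_path (s : R) : V -> R := trail V x (walk_weight s) n.

Lemma walk_weight_staged s : staged (walk_weight s).
Proof.
  intros j. unfold walk_weight. split; [apply clamp_bounds|]. intros H.
  rewrite S_INR. destruct (clamp_cases (INR n * s - INR j)) as [C | [C | C]];
    try lra; apply clamp_low; lra.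
Qed.

Lemma edge_clique i : list_clique (x i :: x (S i) :: nil).
Proof.
  apply list_clique_near. intros a b [<- | [<- | []]] [<- | [<- | []]]; auto.
Qed.

Lemma walk_path_stage s i : (i <= n)%nat ->
  (forall j, (j < i)%nat -> walk_weight s j = 1) ->
  (forall j, (i < j < n)%nat -> walk_weight s j = 0) ->
  simplex (x i :: x (S i) :: nil) (walk_path s).
Proof.
  intros Hi H1 H0. set (c := walk_weight s i).
  assert (Hc : 0 <= c <= 1) by apply walk_weight_staged.
  assert (E : walk_path s = mix V ((1 - c, x i) :: (c, x (S i)) :: nil)).
  { extensionality v. unfold walk_path. rewrite (trail_stage V x _ n n i); auto.
    unfold mix. simpl. fold c. ring. }
  rewrite E. apply mix_simplex.
  - intros d y [Ey | [Ey | []]]; injection Ey as <- <-; simpl; split; auto; lra.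
  - simpl. ring.
  - apply edge_clique.
Qed.

Lemma walk_path_cont : path_cont V adj walk_path.
Proof.
  split.
  - intros s _. destruct (stage_exists _ n (walk_weight_staged s)) as [i [Hi [H1 [H0 _]]]].
    apply (walk_path_stage s i Hi H1 H0).
  - intros U HU t Ht Ut.
    set (B := fun d z : R => Rabs (z - t) < d).
    assert (B_mono : forall d e z, d <= e -> B d z -> B e z) by (unfold B; intros; lra).
    assert (Hw : forall j, tends R B (fun z => walk_weight z j) (walk_weight t j)).
    { intros j. unfold walk_weight. apply tends_clamp, tends_minus; auto.
      - apply tends_mult; auto; [apply tends_const|]. intros e He. exists e. auto.
      - apply tends_const. }
    destruct (simplexwise_continuous V adj R B B_mono walk_path (walk_path t)
      (map (fun i => x i :: x (S i) :: nil) (seq 0 (S n))) U) as [e [He HeU]]; auto.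
    + intros l Hl. apply in_map_iff in Hl as [i [<- _]]. apply edge_clique.
    + eapply ultimately_imp; [|apply (stage_persists R B B_mono (fun j z => walk_weight z j) _ n
        Hw (walk_weight_staged t))].
      intros z Hst.
      destruct (stage_exists _ n (walk_weight_staged z)) as [i [Hi [H1 [H0 _]]]].
      exists (x i :: x (S i) :: nil). split.
      { apply (in_map (fun i => x i :: x (S i) :: nil)), in_seq. lia. }
      split; apply walk_path_stage; auto.
      * intros j Hj. apply Hst; [lia | auto].
      * intros j Hj. apply Hst; [lia | auto].
    + intros v. apply (tends_trail V R B B_mono x (fun j z => walk_weight z j)). auto.
    + exists e. split; auto.
Qed.

Lemma walk_path_pos s j : (j <= n)%nat -> INR j <= INR n * s < INR j + 1 ->
  0 < walk_path s (x j).
Proof.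
  intros Hj Hs. unfold walk_path. rewrite (trail_stage V x _ n n j); auto.
  - rewrite delta_same. pose proof (delta_bounds V (x (S j)) (x j)) as Hd.
    unfold walk_weight. rewrite clamp_mid by lra.
    assert (0 <= (INR n * s - INR j) * delta (x (S j)) (x j)) by (apply Rmult_le_pos; lra).
    lra.
  - intros i Hi. apply clamp_high. apply (le_INR (S i)) in Hi. rewrite S_INR in Hi. lra.
  - intros i Hi. apply clamp_low. assert (Hi' : (S j <= i)%nat) by lia.
    apply le_INR in Hi'. rewrite S_INR in Hi'. lra.
Qed.

Lemma walk_path_0 : walk_path 0 = delta (x O).
Proof.
  extensionality v. unfold walk_path. rewrite (trail_stage V x _ n n 0); auto; try lia.
  - unfold walk_weight. rewrite clamp_low; [ring | simpl; lra].
  - intros j Hj. apply clamp_low. pose proof (pos_INR j). lra.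
Qed.

Lemma walk_path_1 : walk_path 1 = delta (x n).
Proof.
  extensionality v. unfold walk_path. apply trail_done. intros j Hj.
  apply clamp_high. apply (le_INR (S j)) in Hj. rewrite S_INR in Hj. lra.
Qed.

End WalkPath.

(** The open stars of vertices cover the complex. Moving the centre of a good square costs as much
    radius as the displacement, so compactness can be used first along each row and then across the
    rows. *)
Lemma Lebesgue_number (K : R -> R -> V -> R) : square_cont V adj K ->
  exists d, 0 < d /\ forall s t, unit_interval s -> unit_interval t ->
    exists v, forall s' t', unit_interval s' -> unit_interval t' ->
      Rabs (s' - s) < d -> Rabs (t' - t) < d -> 0 < K s' t' v.
Proof.
  intros [Hr Hc].
  set (good := fun d s t => exists v, forall s' t', unit_interval s' -> unit_interval t' ->
      Rabs (s' - s) < d -> Rabs (t' - t) < d -> 0 < K s' t' v).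
  assert (Hshrink : forall d e s t s0 t0, e + Rabs (s - s0) <= d -> e + Rabs (t - t0) <= d ->
            good d s0 t0 -> good e s t).
  { intros d e s t s0 t0 Hs Ht [v Hv]. exists v. intros s' t' Hs' Ht' H1 H2. apply Hv; auto.
    - replace (s' - s0) with ((s' - s) + (s - s0)) by ring.
      eapply Rle_lt_trans; [apply Rabs_triang | lra].
    - replace (t' - t0) with ((t' - t) + (t - t0)) by ring.
      eapply Rle_lt_trans; [apply Rabs_triang | lra]. }
  assert (Hself : forall r, Rabs (r - r) = 0) by (intros; now rewrite Rminus_diag, Rabs_R0).
  assert (Hmin : forall d e s t, 0 < d -> good d s t -> good (Rmin d e) s t).
  { intros d e s t Hd. apply Hshrink; rewrite Hself; pose proof (Rmin_l d e); lra. }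
  assert (Hmin' : forall d e s t, 0 < e -> good e s t -> good (Rmin d e) s t).
  { intros d e s t He. apply Hshrink; rewrite Hself; pose proof (Rmin_r d e); lra. }
  assert (Hpoint : forall s t, unit_interval s -> unit_interval t ->
            exists d, 0 < d /\ good d s t).
  { intros s t Hs Ht. destruct (realization_pos V adj (K s t)) as [v Hv]; auto.
    destruct (Hc _ (open_star V adj v) s t Hs Ht (conj (Hr s t Hs Ht) Hv)) as [e [He H]].
    exists e. split; auto. exists v. intros s' t' Hs' Ht' H1 H2. now apply H. }
  assert (Hrow : forall t, unit_interval t -> exists d, 0 < d /\
            forall s, 0 <= s <= 1 -> good d s t).
  { intros t Ht. apply (interval_induction 0 1
      (fun a b => exists d, 0 < d /\ forall s, a <= s <= b -> good d s t)); [lra| |].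
    - intros a b c Habc [d [Hd H1]] [e [He H2]]. exists (Rmin d e).
      split; [now apply Rmin_glb_lt|]. intros s Hs.
      destruct (Rle_lt_dec s b); [apply Hmin | apply Hmin']; auto; [apply H1 | apply H2]; lra.
    - intros s Hs. destruct (Hpoint s t Hs Ht) as [d [Hd Hg]].
      exists (d / 2). split; [lra|]. intros a b Ha Hb Ha' Hb'. exists (d / 2).
      split; [lra|]. intros s' Hs'. apply (Hshrink d _ _ _ s t); auto; [|rewrite Hself; lra].
      assert (Rabs (s' - s) < d / 2) by (apply Rabs_def1; lra). lra. }
  assert (Hall : exists d, 0 < d /\ forall t, 0 <= t <= 1 -> forall s, 0 <= s <= 1 -> good d s t).
  { apply (interval_induction 0 1 (fun a b => exists d, 0 < d /\
      forall t, a <= t <= b -> forall s, 0 <= s <= 1 -> good d s t)); [lra| |].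
    - intros a b c Habc [d [Hd H1]] [e [He H2]]. exists (Rmin d e).
      split; [now apply Rmin_glb_lt|]. intros t Ht s Hs.
      destruct (Rle_lt_dec t b); [apply Hmin | apply Hmin']; auto; [apply H1 | apply H2]; lra.
    - intros t Ht. destruct (Hrow t Ht) as [d [Hd Hg]].
      exists (d / 2). split; [lra|]. intros a b Ha Hb Ha' Hb'. exists (d / 2).
      split; [lra|]. intros t' Ht' s Hs. apply (Hshrink d _ _ _ s t); auto; [rewrite Hself; lra|].
      assert (Rabs (t' - t) < d / 2) by (apply Rabs_def1; lra). lra. }
  destruct Hall as [d [Hd Hall]]. exists d. split; auto. intros s t Hs Ht. now apply Hall.
Qed.

(* The null-homotopy is cut into a fine grid, each cell being labelled by a vertex whose
   open star contains the image of the cell. Rows of labels are walks, and consecutive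
   rows have lifts with the same ends. *)
Lemma covers_split_of_simply_connected : simply_connected_X V adj -> covers_split V adj.
Proof.
  intros [_ [_ Hloops]] M N f C n P HP Hclosed.
  destruct (Nat.eq_dec n 0) as [-> | Hn0]; auto.
  assert (Hn : (0 < n)%nat) by lia.
  set (a := f (P O)).
  set (x := fun i => f (P (Nat.min i n))).
  assert (Hx : forall i, near (x i) (x (S i))).
  { intros i. unfold x. destruct (Nat.le_gt_cases n i).
    - rewrite !Nat.min_r by lia. auto.
    - rewrite !Nat.min_l by lia. apply (cover_near _ _ _ _ _ C). auto. }
  assert (Hstop : forall j, (n <= j)%nat -> x j = x n).
  { intros j Hj. unfold x. now rewrite !Nat.min_r by lia. }
  assert (Hx0 : x O = a) by reflexivity.
  assert (Hxn : x n = a) by (unfold x; rewrite Nat.min_id; exact Hclosed).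
  set (g := walk_path x n).
  destruct (Hloops g (delta a)) as (K & HK & HKbot & HKtop & HKside).
  { now apply walk_path_cont. }
  { unfold g. rewrite walk_path_0; auto. }
  { unfold g. rewrite walk_path_1. now rewrite Hxn. }
  destruct (Lebesgue_number K HK) as [d [Hd Hleb]].
  destruct (archimed_cor1 d Hd) as [r [Hrd Hr]].
  (* Each of the [n] edges of the walk is cut into [r] pieces, so the grid fits the walk and its
     mesh is at most [/ INR r < d]. *)
  set (m := (n * r)%nat).
  assert (HrR : 0 < INR r) by now apply lt_0_INR.
  assert (HnR : 1 <= INR n) by (apply (le_INR 1); lia).
  assert (HmE : INR m = INR n * INR r) by (unfold m; now rewrite mult_INR).
  assert (Hm : 0 < INR m) by (rewrite HmE; apply Rmult_lt_0_compat; lra).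
  assert (Hmd : / INR m < d).
  { eapply Rle_lt_trans; [|exact Hrd]. apply Rinv_le_contravar; auto.
    rewrite HmE. rewrite <- (Rmult_1_l (INR r)) at 1. apply Rmult_le_compat_r; lra. }
  set (pt := fun i : nat => INR i / INR m).
  assert (Hpt : forall i, (i <= m)%nat -> unit_interval (pt i)).
  { intros i Hi. apply le_INR in Hi. pose proof (pos_INR i). split; unfold pt.
    - apply Rmult_le_pos; auto. apply Rlt_le, Rinv_0_lt_compat; auto.
    - apply (Rmult_le_reg_r (INR m)); auto. field_simplify; lra. }
  assert (Hptnear : forall i i', (i <= i' <= S i)%nat -> Rabs (pt i' - pt i) < d).
  { intros i i' Hi. assert (Hc : i' = i \/ i' = S i) by lia. unfold pt. destruct Hc as [-> | ->].
    - rewrite Rminus_diag, Rabs_R0. auto.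
    - rewrite S_INR. replace ((INR i + 1) / INR m - INR i / INR m) with (/ INR m) by (field; lra).
      rewrite Rabs_pos_eq; auto. apply Rlt_le, Rinv_0_lt_compat; auto. }
  assert (Hlab : forall i j, exists v, (i <= m)%nat -> (j <= m)%nat ->
            forall i' j', (i <= i' <= S i)%nat -> (j <= j' <= S j)%nat ->
              (i' <= m)%nat -> (j' <= m)%nat -> 0 < K (pt i') (pt j') v).
  { intros i j. destruct (Nat.le_gt_cases i m) as [Hi | Hi]; [|exists a; lia].
    destruct (Nat.le_gt_cases j m) as [Hj | Hj]; [|exists a; lia].
    destruct (Hleb (pt i) (pt j)) as [v Hv]; auto. exists v. intros. apply Hv; auto. }
  set (lab := fun i j => proj1_sig (constructive_indefinite_description _ (Hlab i j))).
  assert (Hlabpos : forall i j i' j', (i <= i' <= S i)%nat -> (j <= j' <= S j)%nat ->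
              (i' <= m)%nat -> (j' <= m)%nat -> 0 < K (pt i') (pt j') (lab i j)).
  { intros i j i' j' Hi Hj Hi' Hj'. unfold lab.
    destruct (constructive_indefinite_description _ (Hlab i j)) as [v Hv]. simpl.
    apply Hv; auto; lia. }
  clearbody lab. clear Hlab Hleb.
  (* Cells with a common corner [(i', j')] carry labels from the support of one point, and a support
     is a clique. *)
  assert (Hnear : forall i j k l i' j', (i <= i' <= S i)%nat -> (j <= j' <= S j)%nat ->
            (k <= i' <= S k)%nat -> (l <= j' <= S l)%nat -> (i' <= m)%nat -> (j' <= m)%nat ->
            near (lab i j) (lab k l)).
  { intros. apply (support_near V adj (K (pt i') (pt j'))); auto. apply HK; auto. }
  assert (Hpt0 : pt O = 0) by (unfold pt; simpl; field; lra).
  assert (Hptm : pt m = 1) by (unfold pt; field; lra).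
  (* On the left, right and top sides the homotopy stays at [delta a], whose only positive
     coordinate is [a]. *)
  assert (Hleft : forall j, (j <= m)%nat -> lab O j = a).
  { intros j Hj. symmetry. apply (delta_pos V). rewrite <- (proj1 (HKside (pt j) (Hpt j Hj))).
    pose proof (Hlabpos O j O j) as H. rewrite Hpt0 in H. apply H; lia. }
  assert (Hright : forall j, (j <= m)%nat -> lab m j = a).
  { intros j Hj. symmetry. apply (delta_pos V). rewrite <- (proj2 (HKside (pt j) (Hpt j Hj))).
    pose proof (Hlabpos m j m j) as H. rewrite Hptm in H. apply H; lia. }
  assert (Htop : forall i, (i <= m)%nat -> lab i m = a).
  { intros i Hi. symmetry. apply (delta_pos V). rewrite <- (HKtop (pt i) (Hpt i Hi)).
    pose proof (Hlabpos i m i m) as H. rewrite Hptm in H. apply H; lia. }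
  assert (HNP0 : N (P O) (P O)).
  { apply (cover_refl _ _ _ _ _ C), (cover_mem _ _ _ _ _ C _ (P 1%nat)). auto. }
  assert (Hlift : forall j, (j <= m)%nat -> exists Q, Q O = P O /\
            (forall i, (i <= m)%nat -> f (Q i) = lab i j) /\
            (forall i, (i < m)%nat -> N (Q i) (Q (S i)))).
  { intros j Hj. apply (lift_exists _ _ _ _ _ _ C m (fun i => lab i j)).
    - eapply (cover_mem _ _ _ _ _ C). eauto.
    - symmetry. now apply Hleft.
    - intros i Hi. apply (Hnear i j (S i) j (S i) j); lia. }
  (* Induction from the top row down, [e] being the number of rows above: the top row is stationary,
     and [ladder] carries the endpoint to the row below. *)
  assert (Hrows : forall e j, (j + e = m)%nat -> forall Q, Q O = P O ->
            (forall i, (i <= m)%nat -> f (Q i) = lab i j) ->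
            (forall i, (i < m)%nat -> N (Q i) (Q (S i))) -> Q m = P O).
  { induction e as [|e IH]; intros j Hj Q HQ0 HQf HQ.
    - assert (j = m) by lia. subst j. rewrite <- HQ0.
      apply (stationary_lift _ _ _ _ _ _ C m); auto.
      intros i Hi. rewrite !HQf, !Htop; auto; lia.
    - destruct (Hlift (S j)) as [Q' [HQ0' [HQf' HQ']]]; [lia|].
      assert (E : Q' m = P O) by (apply (IH (S j)); auto; lia).
      assert (HN : N (Q m) (Q' m)).
      { apply (ladder V adj _ M N f C m); auto.
        - now rewrite HQ0, HQ0'.
        - intros i Hi. rewrite HQf, HQf' by lia.
          apply (Hnear i j (S i) (S j) (S i) (S j)); lia.
        - intros i Hi. rewrite HQf, HQf' by lia.
          apply (Hnear (S i) j (S i) (S j) (S i) (S j)); lia. }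
      rewrite E in HN. apply (cover_inj _ _ _ _ _ C (P O)); auto.
      + now apply (cover_sym _ _ _ _ _ C).
      + rewrite HQf by lia. apply Hright. lia. }
  destruct (Hlift O) as [Q [HQ0 [HQf HQ]]]; [lia|].
  assert (HQm : Q m = P O) by (apply (Hrows m O); auto).
  (* The given lift slowed down by the factor [r], so that it runs parallel to the lift of the
     bottom row of labels. *)
  set (Y := fun i => P (i / r)%nat).
  assert (Hdiv : forall i, (i <= m)%nat -> (i / r <= n)%nat).
  { intros i Hi. apply Nat.Div0.div_le_upper_bound. unfold m in Hi. lia. }
  assert (HYf : forall i, (i <= m)%nat -> f (Y i) = x (i / r)%nat).
  { intros i Hi. unfold Y, x. now rewrite Nat.min_l by auto. }
  assert (HY : forall i, (i < m)%nat -> N (Y i) (Y (S i))).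
  { intros i Hi. unfold Y.
    assert (Hs : (S i / r = i / r \/ S i / r = S (i / r))%nat).
    { pose proof (Nat.div_mod_eq i r). pose proof (Nat.mod_upper_bound i r).
      destruct (Nat.eq_dec (S (i mod r)) r) as [E | E].
      - right. symmetry. apply (Nat.div_unique (S i) r _ 0); lia.
      - left. symmetry. apply (Nat.div_unique (S i) r _ (S (i mod r))); lia. }
    pose proof (Hdiv (S i) Hi). destruct Hs as [E | E]; rewrite E in *.
    - apply (cover_refl _ _ _ _ _ C). destruct (Nat.eq_dec (i / r) n) as [E' | E'].
      + rewrite E'. destruct n as [|n']; [lia|]. apply (cover_mem _ _ _ _ _ C _ (P n')).
        apply (cover_sym _ _ _ _ _ C). auto.
      + apply (cover_mem _ _ _ _ _ C _ (P (S (i / r)))). apply HP. lia.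
    - apply HP. lia. }
  (* At the bottom grid point [pt i] the path lies in the open star of [x (i / r)] and in that of
     the label, so these two vertices are near. *)
  assert (HQY : forall i k, (k <= i <= S k)%nat -> (i <= m)%nat ->
            near (f (Q k)) (f (Y i))).
  { intros i k Hk Hi. rewrite HQf, HYf by lia.
    apply (support_near V adj (K (pt i) (pt O))).
    - apply HK; auto. apply Hpt. lia.
    - apply Hlabpos; lia.
    - rewrite Hpt0, HKbot by auto. apply walk_path_pos; auto.
      assert (Epos : INR n * pt i = INR i / INR r) by (unfold pt; rewrite HmE; field; lra).
      rewrite Epos. pose proof (Nat.div_mod_eq i r) as Ei. pose proof (Nat.mod_upper_bound i r) as Hmod.
      assert (Hi1 : (r * (i / r) <= i)%nat) by lia.
      assert (Hi2 : (i < r * (i / r) + r)%nat) by lia.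
      apply le_INR in Hi1. apply lt_INR in Hi2. rewrite plus_INR in Hi2. rewrite mult_INR in *.
      split.
      + apply (Rmult_le_reg_r (INR r)); auto. unfold Rdiv. rewrite Rmult_assoc, Rinv_l; lra.
      + apply (Rmult_lt_reg_r (INR r)); auto. unfold Rdiv. rewrite Rmult_assoc, Rinv_l; lra. }
  assert (HNm : N (Q m) (Y m)).
  { apply (ladder V adj _ M N f C m); auto.
    unfold Y. rewrite HQ0, Nat.Div0.div_0_l. auto. }
  assert (EY : Y m = P n).
  { unfold Y, m. now rewrite Nat.div_mul by lia. }
  rewrite HQm, EY in HNm. apply (cover_inj _ _ _ _ _ C (P O)); auto.
Qed.

End Monodromy.

Theorem theorem3p8 (V : Type) (adj : V -> V -> Prop) :
  is_graph V adj ->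
  (Helly_graph V adj <-> one_Helly V adj /\ weakly_modular V adj) /\
  (Helly_graph V adj <-> clique_Helly V adj /\ dismantlable V adj) /\
  (Helly_graph V adj <-> clique_Helly V adj /\ simply_connected_X V adj) /\
  (finite_dim_clique_complex V adj ->
    (Helly_graph V adj <-> clique_Helly V adj /\ contractible_X V adj)).
Proof.
  intros G.
  assert (Hlocal : clique_Helly V adj -> covers_split V adj -> Helly_graph V adj).
  { intros HCH SC. pose proof (ball_dominated_of_covers_split V adj G HCH SC) as HD.
    apply (Helly_of_ball_dominated V adj G HD).
    now apply (one_Helly_of_clique_Helly V adj G). }
  assert (Hcontr : Helly_graph V adj -> contractible_X V adj).
  { intros HG. destruct (nonempty V adj G) as [u _].
    apply (contractible_of_ball_dominated V adj G u). now apply Helly_ball_dominated. }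
  split; [|split; [|split]].
  - split.
    + intros HG. split; [now apply Helly_one_Helly | now apply (Helly_weakly_modular V adj G)].
    + intros [H1 WM]. apply (Helly_of_ball_dominated V adj G); auto.
      apply ball_dominated_of_one_Helly; auto. now apply one_Helly_iff.
  - split.
    + intros HG. split; [now apply (Helly_clique_Helly V adj G)|].
      apply (dismantlable_of_ball_dominated V adj G). now apply Helly_ball_dominated.
    + intros [HCH HDis]. apply Hlocal; auto. now apply covers_split_of_dismantlable.
  - split.
    + intros HG. split; [now apply (Helly_clique_Helly V adj G)|].
      apply simply_connected_of_contractible. auto.
    + intros [HCH HSC]. apply Hlocal; auto. now apply covers_split_of_simply_connected.
  - intros _. split.
    + intros HG. split; [now apply (Helly_clique_Helly V adj G)|]. auto.
    + intros [HCH HC]. apply Hlocal; auto. apply covers_split_of_simply_connected; auto.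
      now apply simply_connected_of_contractible.
Qed.
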